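(* Let $U\subseteq R^m(-\mathbf d)$ be a quasi-stable module and $D=\min\{i\mid x_i=\min(x^\alpha),\ x^\alpha\mathbf e_k\in\mathcal P_U\}$. The functor $\underline{\mathbf{Mf}}^{\mathrm{res}}_U$ is represented by the scheme $$\mathbf{Mf}^{\mathrm{res}}_U:=\mathrm{Spec}\Bigl(\mathbb K\bigl[C,B^{(1)},\dots,B^{(n-D)}\bigr]/\bigl(\mathscr S^{(1)}+\dots+\mathscr S^{(n-D)}\bigr)\Bigr).$$ An explicit isomorphism between $\mathbf{Mf}^{\mathrm{res}}_U$ and $\mathbf{Mf}_U=\mathrm{Spec}(\mathbb K[C]/\mathscr U)$ is obtained by recursively eliminating the parameters in each $B^{(t)}$, i.e. $\mathscr U=(\mathscr S^{(1)}+\dots+\mathscr S^{(n-D)})\cap\mathbb K[C]$.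
   Context: $\mathbb K$ is a field, $R=\mathbb K[x_0,\dots,x_n]$ with the standard grading and $x_0<\dots<x_n$; for a $\mathbb K$-algebra $A$, $R_A=R\otimes_{\mathbb K}A$. A term of $R$ is a monomial $x^\alpha$; for $x^\alpha\neq1$, $\min(x^\alpha)$, $\max(x^\alpha)$ are the smallest and largest variable dividing it. Variables $x_i>\min(x^\alpha)$ are non-multiplicative for $x^\alpha$ (the term $1$ has none). $R_A^m(-\mathbf d)=\bigoplus_k R_A(-d_k)\mathbf e_k$, with terms $x^\alpha\mathbf e_k$ of degree $|\alpha|+d_k$. All submodules are graded. For a monomial submodule $U$ (generated by terms), $\mathcal N(U)$ is the set of terms not in $U$. Pommaret cone: $\mathcal C(x^\alpha)=\{x^\delta x^\alpha\mid\delta_i=0\ \forall x_i>\min(x^\alpha)\}$ for $x^\alpha\neq 1$, $\mathcal C(1)=$ all terms, $\mathcal C(x^\alpha\mathbf e_k)=\mathcal C(x^\alpha)\mathbf e_k$. A Pommaret basis of $U$ is a set of terms generating $U$ whose cones partition the set of terms of $U$; it is unique if it exists, denoted $\mathcal P_U$. $U$ is quasi-stable if it has a finite Pommaret basis, stable if moreover $\mathcal P_U$ is its minimal monomial generating set. A $U$-marked set is a finite set $F=\{f_\tau\}_{\tau\in\mathcal P_U}\subset R_A^m(-\mathbf d)$ of homogeneous elements such that $\tau$ has coefficient $1$ in $f_\tau$ and the support of $f_\tau-\tau$ is in $\mathcal N(U)$; it is a $U$-marked basis of $(F)$ if $R_A^m(-\mathbf d)=(F)\oplus\langle\mathcal N(U)\rangle_A$.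 A graded submodule $M$ satisfies $M\oplus\langle\mathcal N(U)\rangle=R_A^m(-\mathbf d)$ iff it is generated by a (unique) $U$-marked basis. In general, given a $U$-marked set, every $f$ has a unique writing $f=\sum P_\sigma f_\sigma+g$ with all terms of $P_\sigma\sigma$ in $\mathcal C(\sigma)$ and $g\in\langle\mathcal N(U)\rangle_A$ ($g$ is the normal form); for a $U$-marked basis, $g=0$ iff $f\in(F)$. For a $U$-marked basis, the fundamental syzygies are $x_i\mathbf f_\tau-\sum P_\sigma\mathbf f_\sigma$, for $x_i$ non-multiplicative for $\tau\in\mathcal P_U$, where $x_if_\tau=\sum P_\sigma f_\sigma$ is the unique writing. They form a marked basis $F^{\partial_1}$ (head terms $x_i\mathbf f_\tau$) of the syzygy module of $F$ over the stable module $U^{(1)}\subset\bigoplus_\tau R(-\deg\tau)\mathbf f_\tau$ with Pommaret basis $\{x_i\mathbf f_\tau\mid x_i\text{ non-multiplicative for }\tau\}$. Put $U^{(0)}=U$, $F^{\partial_0}=F$; iterating, $F^{\partial_t}$ is the set of fundamental syzygies of $F^{\partial_{t-1}}$, a $U^{(t)}$-marked basis with $U^{(t)}=(U^{(t-1)})^{(1)}$. Functors on Noetherian $\mathbb K$-algebras: $\underline{\mathbf{Mf}}_U(A)$ is the set of $M\subset R_A^m(-\mathbf d)$ with $M\oplus\langle\mathcal N(U)\rangle=R_A^m(-\mathbf d)$; $\underline{\mathbf{Mf}}^{\mathrm{res}}_U(A)$ is the set of tuples $(M,S_1,\dots,S_{n-D})$ with $M\in\underline{\mathbf{Mf}}_U(A)$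 with $U$-marked basis $F$ and $S_t$ the syzygy module of $F^{\partial_{t-1}}$ for all $t>0$; both act on morphisms by extension of scalars. Parameters. $C=\{C_\tau^{\nu}\mid\tau\in\mathcal P_U,\ \nu\in\mathcal N(U),\ \deg\nu=\deg\tau\}$; $\mathcal F=\{F_\tau\}$, $F_\tau=\tau-\sum C_\tau^\nu\nu$, is the generic $U$-marked set, and $\mathscr U\subseteq\mathbb K[C]$ is generated by all coefficients of the normal forms with respect to $\mathcal F$ of the elements $x_iF_\tau$, $\tau\in\mathcal P_U$, $x_i$ non-multiplicative for $\tau$. It is known that $\mathbf{Mf}_U=\mathrm{Spec}(\mathbb K[C]/\mathscr U)$ represents $\underline{\mathbf{Mf}}_U$. For $t\ge1$, $\tau\in\mathcal P_{U^{(t-1)}}$ and $x_i$ non-multiplicative for $\tau$, let $\mathsf s^{(t)}_{i,\tau}$ be the set of terms $x^\eta\mathbf f_\sigma\in\mathcal N(U^{(t)})$, $\sigma\in\mathcal P_{U^{(t-1)}}$, with $\max(x^\eta)\le\min\{x_{i-1},\min(\sigma)\}$ ($\min(\sigma)$ the least variable of the monomial part of $\sigma$; $x^\eta=1$ allowed; if the monomial part of $\sigma$ is $1$ only $\max(x^\eta)\le x_{i-1}$ is required) and $\deg x^\eta\mathbf f_\sigma=\deg\tau+1$. $B^{(t)}$ is a set of indeterminates $B_{i,\tau}^{\eta,\sigma}$, one for each $(i,\tau)$ and each $x^\eta\mathbf f_\sigma\in\mathsf s^{(t)}_{i,\tau}$. $M_0$ is the matrix whose columns are the elements of $\mathcal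 F$; for $t\ge1$, $M_t$ is the matrix whose columns are the pre-syzygies $x_i\mathbf f_\tau-\sum_{\mathsf s^{(t)}_{i,\tau}}B_{i,\tau}^{\eta,\sigma}x^\eta\mathbf f_\sigma$. $\mathscr S^{(t)}$ is the ideal generated in $\mathbb K[C,B^{(1)},\dots,B^{(n-D)}]$ by the coefficients (with respect to the variables $x_0,\dots,x_n$) of the entries of $M_{t-1}M_t$. *)

(* Defs.v *)
From HB Require Import structures.
From mathcomp Require Import all_boot all_order all_algebra.
From mathcomp Require Import ring_quotient generic_quotient boolp.
From mathcomp.multinomials Require Import mpoly.

Set Implicit Arguments.
Unset Strict Implicit.
Unset Printing Implicit Defensive.

Import GRing.Theory.
Local Open Scope ring_scope.
Local Open Scope quotient_scope.

Definition ideal_gen (P : comNzRingType) (G : P -> Prop) : P -> Prop :=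
  fun x => exists s : seq (P * P),
    (forall p, p \in s -> G p.2) /\ x = \sum_(p <- s) p.1 * p.2.

Definition noetherian (A : comNzRingType) : Prop :=
  forall I : A -> Prop,
    I 0 -> (forall x y, I x -> I y -> I (x + y)) ->
    (forall a x, I x -> I (a * x)) ->
    exists s : seq A, forall x, I x <-> ideal_gen (fun y => y \in s) x.

Section Quotient.
Variables (P : comNzRingType) (G : P -> Prop).

Definition ideal_pred : {pred P} := fun x => `[< ideal_gen G x >].

Lemma ideal_gen0 : ideal_gen G 0.
Proof. by exists [::]; split=> //; rewrite big_nil. Qed.

Lemma ideal_genD x y : ideal_gen G x -> ideal_gen G y -> ideal_gen G (x + y).
Proof.
move=> [s [Hs ->]] [t [Ht ->]]; exists (s ++ t); split; last by rewrite big_cat.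
by move=> p; rewrite mem_cat => /orP [/Hs|/Ht].
Qed.

Lemma ideal_genM a x : ideal_gen G x -> ideal_gen G (a * x).
Proof.
move=> [s [Hs ->]]; exists [seq (a * p.1, p.2) | p <- s]; split.
  by move=> _ /mapP [p /Hs Hp ->].
by rewrite big_map mulr_sumr; apply: eq_bigr => p _; rewrite -mulrA.
Qed.

Fact ideal_pred_zmod : zmod_closed ideal_pred.
Proof.
split=> [|x y]; first by apply/asboolP/ideal_gen0.
move=> /asboolP Hx /asboolP Hy; apply/asboolP.
by rewrite -(mulN1r y); apply/ideal_genD/ideal_genM.
Qed.

HB.instance Definition _ := GRing.isZmodClosed.Build P ideal_pred ideal_pred_zmod.

(* The quotient P / (G). The library only provides the quotient of a ring by
   a proper ideal; here the ideal is arbitrary, so that the result may be the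
   zero ring. *)
Definition ideal_zmod : zmodClosed P := ideal_pred.
Definition qring : Type := Quotient.quot ideal_zmod.
HB.instance Definition _ := Choice.on qring.
HB.instance Definition _ := GRing.Zmodule.on qring.

Definition qproj (x : P) : qring := \pi_(Quotient.quot ideal_zmod) x.

Lemma qproj_eq x y : qproj x = qproj y <-> ideal_gen G (x - y).
Proof.
split=> [H|H].
  by apply/asboolP; move/eqP: H; rewrite -Quotient.idealrBE.
by apply/eqP; rewrite -Quotient.idealrBE; apply/asboolP.
Qed.

Lemma qproj_surj (q : qring) : exists x, q = qproj x.
Proof. by exists (repr q); rewrite /qproj reprK. Qed.

Fact qproj_additive : zmod_morphism qproj.
Proof. by move=> x y; rewrite /qproj raddfB. Qed.

Definition qone : qring := qproj 1.
Definition qmul (p q : qring) : qring :=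
  qproj (repr (p : Quotient.quot ideal_zmod) *
         repr (q : Quotient.quot ideal_zmod)).

Lemma qmulE x y : qmul (qproj x) (qproj y) = qproj (x * y).
Proof.
have rK z : ideal_gen G (repr (qproj z : Quotient.quot ideal_zmod) - z).
  by apply/qproj_eq; rewrite /qproj reprK.
apply/qproj_eq; set a := repr _; set b := repr _.
have -> : a * b - x * y = b * (a - x) + x * (b - y).
  by rewrite !mulrBr addrA (mulrC b x) subrK (mulrC b a).
by apply/ideal_genD/ideal_genM/rK/ideal_genM/rK.
Qed.

Fact qmulA : associative qmul.
Proof.
move=> p q r; have [x ->] := qproj_surj p; have [y ->] := qproj_surj q.
by have [z ->] := qproj_surj r; rewrite !qmulE mulrA.
Qed.

Fact qmulC : commutative qmul.
Proof.
move=> p q; have [x ->] := qproj_surj p; have [y ->] := qproj_surj q.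
by rewrite !qmulE mulrC.
Qed.

Fact qmul1 : left_id qone qmul.
Proof. by move=> p; have [x ->] := qproj_surj p; rewrite qmulE mul1r. Qed.

Fact qmulDl : left_distributive qmul +%R.
Proof.
move=> p q r; have [x ->] := qproj_surj p; have [y ->] := qproj_surj q.
have [z ->] := qproj_surj r; rewrite !qmulE.
have qD u v : qproj (u + v) = (qproj u : qring) + qproj v.
  by rewrite /qproj raddfD.
by rewrite -qD qmulE mulrDl qD.
Qed.

HB.instance Definition _ :=
  GRing.Zmodule_isComPzRing.Build qring qmulA qmulC qmul1 qmulDl.

HB.instance Definition _ :=
  GRing.isZmodMorphism.Build P qring qproj qproj_additive.

Fact qproj_monoid : monoid_morphism qproj.
Proof. by split=> // x y; rewrite -qmulE. Qed.

HB.instance Definition _ := GRing.isMonoidMorphism.Build P qring qproj qproj_monoid.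

End Quotient.

(* A set-valued functor on K-algebras, given as a family of subsets
   [fmem A] of types [fobj A] whose equality is [feq]. *)
Record kfunctor (K : fieldType) := KFunctor {
  fobj : comAlgType K -> Type;
  feq  : forall A : comAlgType K, fobj A -> fobj A -> Prop;
  fmem : forall A : comAlgType K, fobj A -> Prop;
  fmap : forall A B : comAlgType K, {lrmorphism A -> B} -> fobj A -> fobj B
}.

(* The A-points of Spec (P / (G)): K-algebra morphisms P / (G) -> A. *)
Record kpoint (K : fieldType) (P : comAlgType K) (G : P -> Prop)
    (A : comAlgType K) := KPoint {
  kpoint_fun :> {rmorphism qring G -> A};
  kpoint_scal : forall c : K, kpoint_fun (qproj G c%:A) = c%:A
}.

Definition represented_by (K : fieldType) (F : kfunctor K)
    (P : comAlgType K) (I : P -> Prop) : Prop :=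
  exists Phi : forall A : comAlgType K, kpoint I A -> fobj F A,
  [/\ forall (A : comAlgType K) (h : kpoint I A),
        noetherian A -> fmem (Phi A h),
      forall (A : comAlgType K) (h h' : kpoint I A),
        noetherian A -> feq (Phi A h) (Phi A h') -> h =1 h',
      forall (A : comAlgType K) (x : fobj F A),
        noetherian A -> fmem x -> exists h : kpoint I A, feq (Phi A h) x
    & forall (A B : comAlgType K) (phi : {lrmorphism A -> B})
          (h : kpoint I A) (h' : kpoint I B),
        noetherian A -> noetherian B -> (forall q, h' q = phi (h q)) ->
        feq (Phi B h') (fmap phi (Phi A h))].

Notation term n I := ('X_{1..n.+1} * I)%type.
Notation vec A n I := {ffun I -> {mpoly A[n.+1]}}.

Section Terms.
Variable n : nat.

(* x_i > min(x^a); never holds for the term 1. *)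
Definition nonmult (a : 'X_{1..n.+1}) (i : 'I_n.+1) : bool :=
  [exists j : 'I_n.+1, (a j != 0%N) && (j < i)%N].

(* Index of min(x^a); by convention n if x^a = 1, for which all variables are
   multiplicative. *)
Definition minv (a : 'X_{1..n.+1}) : 'I_n.+1 :=
  [arg min_(j < ord_max | a j != 0%N) (j : nat)].

Variable I : finType.

Definition tmul (a : 'X_{1..n.+1}) (s : term n I) : term n I :=
  ((a + s.1)%MM, s.2).

Definition cone (s t : term n I) : Prop :=
  exists2 a : 'X_{1..n.+1},
    t = tmul a s & forall i, nonmult s.1 i -> a i = 0%N.

Variable deg : I -> int.

Definition tdeg (t : term n I) : int := (mdeg t.1)%:Z + deg t.2.

End Terms.

Section FreeModule.
Variables (n : nat) (A : comNzRingType) (I : finType).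

Definition tvec (t : term n I) : vec A n I :=
  [ffun k => if k == t.2 then 'X_[t.1] else 0].

Definition vscale (p : {mpoly A[n.+1]}) (v : vec A n I) : vec A n I :=
  [ffun k => p * v k].

Definition is_submod (M : vec A n I -> Prop) : Prop :=
  [/\ M 0, forall u v, M u -> M v -> M (u + v) & forall p v, M v -> M (vscale p v)].

Definition lincomb (J : finType) (p : vec A n J) (F : J -> vec A n I) : vec A n I :=
  \sum_(j : J) vscale (p j) (F j).

Definition mspan (J : finType) (F : J -> vec A n I) : vec A n I -> Prop :=
  fun v => exists p : vec A n J, v = lincomb p F.

Definition syz (J : finType) (F : J -> vec A n I) : vec A n J -> Prop :=
  fun p => lincomb p F = 0.

Variable deg : I -> int.

Definition is_homog (e : int) (v : vec A n I) : Prop :=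
  forall k a, (v k)@_a != 0 -> tdeg deg (a, k) = e.

Definition is_graded (M : vec A n I -> Prop) : Prop :=
  forall v, M v -> exists s : seq (vec A n I),
    (forall u, u \in s -> M u /\ exists e, is_homog e u) /\ v = \sum_(u <- s) u.

Definition direct_complement (M N : vec A n I -> Prop) : Prop :=
  (forall v, exists w g, [/\ M w, N g & v = w + g]) /\
  (forall v, M v -> N v -> v = 0).

End FreeModule.

Arguments tvec {n} A {I} t.

Definition vmap (n : nat) (A B : comNzRingType) (I : finType)
    (phi : {rmorphism A -> B}) (v : vec A n I) : vec B n I :=
  [ffun k => map_mpoly phi (v k)].

(* The image of M (x)_A B in R_B^I. *)
Definition extend (n : nat) (A B : comNzRingType) (I : finType)
    (phi : {rmorphism A -> B}) (M : vec A n I -> Prop) : vec B n I -> Prop :=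
  fun w => exists s : seq (vec A n I),
    (forall v, v \in s -> M v) /\
    mspan (fun i : 'I_(size s) => vmap phi (nth 0 s i)) w.

(* U is quasi-stable when it has such a basis P; then P is unique (as a set),
   and U is a monomial submodule. The finite set P is given by a
   duplicate-free list. *)
Definition pommaret_basis (K : fieldType) (n : nat) (I : finType)
    (U : vec K n I -> Prop) (P : seq (term n I)) : Prop :=
  [/\ uniq P,
      forall v, U v <-> mspan (fun s : seq_sub P => tvec K (val s)) v,
      forall t, U (tvec K t) <-> exists2 s, s \in P & cone s t
    & forall s s' t, s \in P -> s' \in P -> cone s t -> cone s' t -> s = s'].

(* A monomial submodule [lU] of the free module on [lidx] with degrees [ldeg],
   together with its Pommaret basis [lpom]. *)
Record level (K : fieldType) (n : nat) := Level {
  lidx : finType;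
  ldeg : lidx -> int;
  lU   : vec K n lidx -> Prop;
  lpom : seq (term n lidx)
}.

Arguments ldeg {K n} l _.

(* U |-> U^(1): the basis element f_s of the new free module is s itself, as
   an element of the finite type [seq_sub (lpom L)]; the term x_i f_s is
   (U_(i), s). *)
Definition next_pom (K : fieldType) (n : nat) (L : level K n) :
    seq (term n (seq_sub (lpom L))) :=
  [seq (U_(p.2)%MM, p.1) | p <- enum {: seq_sub (lpom L) * 'I_n.+1}
                         & nonmult (val p.1).1 p.2].

Definition next (K : fieldType) (n : nat) (L : level K n) : level K n :=
  {| lidx := seq_sub (lpom L);
     ldeg := fun s => tdeg (ldeg L) (val s);
     lU   := mspan (fun c : seq_sub (next_pom L) => tvec K (val c));
     lpom := next_pom L |}.

Fixpoint lev (K : fieldType) (n : nat) (L : level K n) (t : nat) : level K n :=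
  if t is t'.+1 then next (lev L t') else L.

(* Families of elements of R_A^I indexed by the Pommaret basis. *)
Definition fam (K : fieldType) (n : nat) (A : comNzRingType) (L : level K n) :=
  seq_sub (lpom L) -> vec A n (lidx L).

Section Marked.
Variables (K : fieldType) (n : nat) (L : level K n) (A : comNzRingType).

Definition inN (t : term n (lidx L)) : Prop := ~ lU (tvec K t).

(* <N(U)>_A *)
Definition spanN (g : vec A n (lidx L)) : Prop :=
  forall k a, (g k)@_a != 0 -> inN (a, k).

Definition marked_set (F : fam A L) : Prop :=
  forall s : seq_sub (lpom L),
  [/\ exists e, is_homog (ldeg L) e (F s),
      (F s (val s).2)@_((val s).1) = 1
    & spanN (F s - tvec A (val s))].

Definition marked_basis (F : fam A L) : Prop :=
  marked_set F /\ direct_complement (mspan F) spanN.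

(* f = \sum_s P_s F_s + g, with all terms of P_s s in the cone of s and g in
   <N(U)>. *)
Definition writing (F : fam A L) (f : vec A n (lidx L))
    (P : vec A n (seq_sub (lpom L))) (g : vec A n (lidx L)) : Prop :=
  [/\ forall s a, (P s)@_a != 0 -> cone (val s) (tmul a (val s)),
      spanN g & f = lincomb P F + g].

(* For c = x_i f_s, [lincomb (tvec A (val c)) F] is x_i F_s. *)
Definition fund_syz (F : fam A L) (G : fam A (next L)) : Prop :=
  forall c : seq_sub (lpom (next L)),
  exists2 P : vec A n (seq_sub (lpom L)),
    writing F (lincomb (tvec A (val c)) F) P 0 & G c = tvec A (val c) - P.

End Marked.

Section MfRes.
Variables (K : fieldType) (n m : nat) (d : 'I_m -> int).
Variables (U : vec K n 'I_m -> Prop) (P : seq (term n 'I_m)).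

Definition L0 : level K n := Level d U P.

(* D, with value n if P contains no term x^a e_k with x^a <> 1. *)
Definition Dmin : nat := \big[minn/n]_(s <- P | s.1 != 0%MM) minv s.1.

Definition reslen : nat := n - Dmin.

Definition inMf (A : comNzRingType) (M : vec A n 'I_m -> Prop) : Prop :=
  [/\ is_submod M, is_graded d M & direct_complement M (@spanN K n L0 A)].

(* [rest i] is S_(i+1), a submodule of the free module containing U^(i+1). *)
Record restuple (A : comNzRingType) := ResTuple {
  resM : vec A n 'I_m -> Prop;
  resS : forall i : 'I_reslen, vec A n (lidx (lev L0 i.+1)) -> Prop
}.
Arguments resM {A} _ _.
Arguments resS {A} _ _ _.

(* [G t] is F^(d_t); only the values for t <= n - D matter. *)
Definition inMfres (A : comNzRingType) (T : restuple A) : Prop :=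
  inMf (resM T) /\
  exists G : forall t : nat, fam A (lev L0 t),
  [/\ marked_basis (G 0%N),
      forall v, resM T v <-> mspan (G 0%N) v,
      forall t, (t < reslen)%N -> fund_syz (G t) (G t.+1)
    & forall (i : 'I_reslen) p, resS T i p <-> syz (G i) p].

Definition Mfres : kfunctor K :=
  {| fobj := fun A => restuple A;
     feq  := fun A T T' =>
       (forall v, resM T v <-> resM T' v) /\
       (forall i p, resS T i p <-> resS T' i p);
     fmem := fun A T => inMfres T;
     fmap := fun A B phi T =>
       ResTuple (extend phi (resM T)) (fun i => extend phi (resS T i)) |}.

(* All terms having the degree of an element of the Pommaret basis satisfy
   mdeg < tbound. *)
Definition tbound (L : level K n) : nat :=
  (\max_(s : seq_sub (lpom L)) \max_(k : lidx L)
     `|tdeg (ldeg L) (val s) - ldeg L k|%N).+1.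

Notation bterm L := ('X_{1..n.+1 < tbound L} * lidx L)%type.

Definition unb (L : level K n) (t : bterm L) : term n (lidx L) :=
  (bmnm t.1, t.2).

(* The index set of the parameters C. *)
Definition Ccond (x : seq_sub (lpom L0) * bterm L0) : bool :=
  `[< inN (unb x.2) >] &&
  (tdeg (ldeg L0) (unb x.2) == tdeg (ldeg L0) (val x.1)).

Definition Cidx : finType := {x : seq_sub (lpom L0) * bterm L0 | Ccond x}.

(* The index set of the parameters B^(t+1): the pairs of c = x_i f_s in the
   Pommaret basis of U^(t+1) and x^a f_s' in the set s^(t+1)_(i,s). As
   (val c).1 is the single variable x_i, i is [minv (val c).1]; the terms x^a
   are those with a_j <> 0 only for j <= i - 1 and j <= min(s'). *)
Definition Bcond (t : nat)
    (x : seq_sub (lpom (lev L0 t.+1)) * bterm (lev L0 t.+1)) : bool :=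
  [&& `[< inN (unb x.2) >],
      tdeg (ldeg (lev L0 t.+1)) (unb x.2)
        == tdeg (ldeg (lev L0 t.+1)) (val x.1)
    & [forall j : 'I_n.+1, ((unb x.2).1 j != 0%N) ==>
         (j < minv (val x.1).1)%N &&
         (j <= minv (val (x.2.2 : seq_sub (lpom (lev L0 t)))).1)%N]].

Definition Bidx (t : nat) : finType :=
  {x : seq_sub (lpom (lev L0 t.+1)) * bterm (lev L0 t.+1) | Bcond x}.

Definition CBidx : finType := (Cidx + {t : 'I_reslen & Bidx t})%type.

Definition KC : comAlgType K := {mpoly K[#|Cidx|]}.
Definition KCB : comAlgType K := {mpoly K[#|CBidx|]}.

Definition CtoCB (p : KC) : KCB :=
  p \mPo [tuple 'X_(enum_rank (inl (enum_val i) : CBidx)) | i < #|Cidx|].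

(* The columns tau - \sum C_tau^nu nu. *)
Definition genF (A : comNzRingType) (C : Cidx -> A) : fam A L0 :=
  fun s => tvec A (val s) -
    \sum_(x : Cidx | (val x).1 == s) vscale (C x)%:MP (tvec A (unb (val x).2)).

(* The ideal of K[C] generated by the coefficients of the normal forms of the
   x_i F_tau. *)
Definition Ucoef (u : KC) : Prop :=
  let F := genF (fun x => 'X_(enum_rank x) : KC) in
  exists (c : seq_sub (lpom (next L0))) p g,
    writing F (lincomb (tvec KC (val c)) F) p g /\ exists k a, u = (g k)@_a.

Definition idealU : KC -> Prop := ideal_gen Ucoef.

(* The matrices M_t, as the families of their columns. *)
Definition M0 : fam KCB L0 :=
  genF (fun x => 'X_(enum_rank (inl x : CBidx)) : KCB).

Definition Bvar (t : 'I_reslen) (x : Bidx t) : KCB :=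
  'X_(enum_rank (inr (Tagged (fun t : 'I_reslen => Bidx t : Type) x) : CBidx)).

Definition MB (t : 'I_reslen) : fam KCB (lev L0 t.+1) :=
  fun c => tvec KCB (val c) -
    \sum_(x : Bidx t | (val x).1 == c)
       vscale (Bvar x)%:MP (tvec KCB (unb (val x).2)).

Definition Mmat (t : nat) : (t <= reslen)%N -> fam KCB (lev L0 t) :=
  match t return (t <= reslen)%N -> fam KCB (lev L0 t) with
  | 0 => fun _ => M0
  | t'.+1 => fun lt => @MB (Ordinal lt)
  end.

(* [idealS t] is the ideal S^(t+1); column c of the product M_t M_(t+1) is
   [lincomb (Mmat _ c) (Mmat _)]. *)
Definition Scoef (t : 'I_reslen) (u : KCB) : Prop :=
  exists (c : seq_sub (lpom (lev L0 t.+1))) k a,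
    u = (lincomb (Mmat (ltn_ord t) c) (Mmat (ltnW (ltn_ord t))) k)@_a.

Definition idealS (t : 'I_reslen) : KCB -> Prop := ideal_gen (@Scoef t).

Definition unionS (u : KCB) : Prop := exists t, idealS t u.

(* S^(1) + ... + S^(n-D) *)
Definition idealSsum : KCB -> Prop := ideal_gen unionS.

(* p lies in K[C, B^(1), ..., B^(t)]. *)
Definition in_KCBlt (t : nat) (p : KCB) : Prop :=
  forall a, a \in msupp p -> forall i : 'I_#|CBidx|, a i != 0%N ->
    if enum_val i is inr x then (tag x < t)%N else true.

End MfRes.

Arguments Mfres {K n m} d U P.
Arguments idealU {K n m} d U P _.
Arguments idealSsum {K n m} d U P _.
Arguments Bidx {K n m} d U P t.

(* Main.v *)
From HB Require Import structures.
From mathcomp Require Import all_boot all_order all_algebra.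
From mathcomp Require Import boolp.
From mathcomp.multinomials Require Import mpoly.
Require Import Defs.

(** Everything rests on one observation about Pommaret bases (mlex_cancel): if a
    product x^a t is decomposed as x^b s with s in the basis and b multiplicative
    for s, then b is lexicographically smaller than a, unless t lies in the cone
    of s.

    For a marked set F this gives, over any commutative ring, the existence of
    writings f = sum P_s F_s + g by terminating reduction (writing_exists), their
    uniqueness by looking at the largest multiplier (writing_uniq), and the fact
    that F is a marked basis when the x_i F_s with x_i non-multiplicative have
    normal form 0 (marked_basis_criterion).

    The submodule U^(1) has the x_i f_s as its Pommaret basis, and the terms outside
    U^(1) are exactly the x^a f_s with multiplicative x^a. So a syzygy that is its
    own normal form is a relation with multiplicative multipliers and vanishes by
    uniqueness. Hence the fundamental syzygies of a marked basis form a marked basis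
    of the syzygy module (fund_syz_basis), and conversely a syzygy of the shape of
    a column of M_(t+1) has to be the fundamental one (fund_syzI).

    Consequently values of the parameters C and B satisfy M_t M_(t+1) = 0 for all t
    if and only if C defines a marked basis and the B are the coefficients of its
    iterated fundamental syzygies (idealSsum_kill, chain_basis0). The bound on the
    multipliers ensures that all these coefficients are among the B
    (chain_complete), and uniqueness of writings that they are determined by the
    module (chain_uniq). This gives representability. Applied to the quotient of
    K[C, B] by the sum of the S^(t), the same facts show that the ideal of normal
    form coefficients is contained in this sum. Applied to the quotient of K[C] by
    that ideal, they show the converse for elements of K[C]. Finally, writings with
    respect to the generic matrix M_t express each B^(t+1), modulo S^(t+1), by
    earlier parameters (Bvar_eliminate), so the induced injection of quotient rings
    is also surjective. *)

Set Implicit Arguments.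
Unset Strict Implicit.
Unset Printing Implicit Defensive.

Import GRing.Theory.
Local Open Scope ring_scope.

(** * The lexicographic order and multiplicative variables *)

Section LexOrder.
Variable n : nat.
Implicit Types a b c : 'X_{1..n.+1}.

(** The lexicographic order for which x_n is the most significant variable. *)
Definition mlex a b : Prop :=
  exists2 i : 'I_n.+1, (a i < b i)%N & forall j : 'I_n.+1, (i < j)%N -> a j = b j.

Lemma mlex_irr a : ~ mlex a a.
Proof. by case=> i; rewrite ltnn. Qed.

Lemma mlex_trans b a c : mlex a b -> mlex b c -> mlex a c.
Proof.
move=> [i lti eqi] [j ltj eqj].
have [ij|ji|/val_inj ij] := ltngtP i j.
- exists j => [|k jk]; first by rewrite eqi.
  by rewrite eqi ?eqj // (ltn_trans ij).
- exists i => [|k ik]; first by rewrite -eqj.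
  by rewrite eqi ?eqj // (ltn_trans ji).
- subst j; exists i => [|k ik]; first exact: ltn_trans ltj.
  by rewrite eqi ?eqj.
Qed.

Lemma mlex_total a b : [\/ mlex a b, a = b | mlex b a].
Proof.
case: (pselect (a = b)) => [->|ab]; first by constructor 2.
have /existsP [i0 Hi0] : [exists i, a i != b i].
  rewrite -[X in is_true X]negbK negb_exists; apply/negP => /forallP H; apply: ab.
  by apply/mnmP => i; apply/eqP; move: (H i); rewrite negbK.
pose i := [arg max_(i > i0 | a i != b i) (i : nat)].
have : [/\ a i != b i & forall j : 'I_n.+1, (i < j)%N -> a j = b j].
  rewrite /i; case: arg_maxnP => // k Hk max; split=> // j kj.
  by apply/eqP/negPn/negP => /max /=; rewrite leqNgt kj.
case=> neq eqs.
case: (ltngtP (a i) (b i)) neq => // lti _.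
- by constructor 1; exists i.
- by constructor 3; exists i => // j /eqs.
Qed.

Lemma mlexD2l c a b : mlex a b -> mlex (c + a)%MM (c + b)%MM.
Proof.
move=> [i lti eqi]; exists i => [|j /eqi eqj]; rewrite !mnmDE ?ltn_add2l //.
by rewrite eqj.
Qed.

(** A monomial may have infinitely many smaller ones, so the induction proceeds
    coordinate by coordinate: assuming Q only for the smaller monomials whose most
    significant difference from a is at x_k or above is shown to suffice by
    induction on k, with an inner induction on the exponent of x_k. *)
Lemma mlex_ind (Q : 'X_{1..n.+1} -> Prop) :
  (forall a, (forall b, mlex b a -> Q b) -> Q a) -> forall a, Q a.
Proof.
move=> IH.
suff H k a : (k <= n.+1)%N ->
    (forall b, (exists2 i : 'I_n.+1, (k <= i)%N /\ (b i < a i)%N &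
                  forall j : 'I_n.+1, (i < j)%N -> b j = a j) -> Q b) -> Q a.
  move=> a; apply: (H n.+1) => // b [i []].
  by rewrite leqNgt ltn_ord.
elim: k a => [|k IHk] a kn Hk.
  by apply: IH => b [i lti eqi]; apply: Hk; exists i.
pose ik := Ordinal kn.
elim: {a}(a ik) {-2}a (leqnn (a ik)) Hk => [|N IHN] a aN Hk.
all: apply: IHk => [|b [i [ki lti] eqi]]; first exact: ltnW.
all: move: ki; rewrite leq_eqVlt => /orP [/eqP ki|ki]; last by apply: Hk; exists i.
all: have {ki}ki : ik = i by apply: val_inj.
all: subst i.
  by move: lti; rewrite leqn0 in aN; rewrite (eqP aN).
apply: IHN; first by rewrite -ltnS (leq_trans lti).
move=> c [i [ki ltc] eqc]; apply: Hk; exists i.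
  by split=> //; rewrite -eqi.
by move=> j ij; rewrite eqc // eqi // (ltn_trans _ ij).
Qed.

Lemma mlex_max (T : eqType) (f : T -> 'X_{1..n.+1}) (s : seq T) (x0 : T) :
  x0 \in s -> exists2 x, x \in s & forall y, y \in s -> ~ mlex (f x) (f y).
Proof.
elim: s x0 => // z s IH x0 _.
case: s IH => [|y s] IH.
  by exists z; rewrite ?mem_head // => y; rewrite inE => /eqP ->; exact: mlex_irr.
have [x xs xmax] := IH y (mem_head _ _).
case: (pselect (mlex (f x) (f z))) => xz.
  exists z; rewrite ?mem_head // => w; rewrite inE => /orP [/eqP ->|ws].
    exact: mlex_irr.
  by move=> zw; apply: (xmax w ws); apply: mlex_trans zw.
exists x; first by rewrite inE xs orbT.
by move=> w; rewrite inE => /orP [/eqP ->|/xmax].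
Qed.

Lemma mlexU a (i j : 'I_n.+1) : mlex a U_(i)%MM -> a j != 0%N -> (j < i)%N.
Proof.
move=> [k]; rewrite mnm1E; case: (i =P k) => [<-{k}|_] //= ai eqi aj; rewrite ltnNge.
apply/negP; rewrite leq_eqVlt => /orP [/eqP /val_inj ij|ij].
  by move: ai aj; rewrite ij; case: (a j).
by move: aj; rewrite (eqi _ ij) mnm1E -val_eqE /= (ltn_eqF ij).
Qed.

Lemma nonmult_trans a (i j : 'I_n.+1) : (i <= j)%N -> nonmult a i -> nonmult a j.
Proof.
move=> ij /existsP [k /andP [ak ki]]; apply/existsP; exists k.
by rewrite ak (leq_trans ki).
Qed.

Lemma nonmultU (i j : 'I_n.+1) : nonmult U_(i)%MM j = (i < j)%N.
Proof.
apply/existsP/idP => [[k]|ij]; last by exists i; rewrite mnm1E eqxx.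
by rewrite mnm1E; case: (i =P k) => [->|_] /=.
Qed.

(** The default value of minv prevents a direct use of the specification of
    minima: it need not satisfy the predicate that is minimised over. *)
Lemma minvP a (j : 'I_n.+1) : a j != 0%N -> a (minv a) != 0%N /\ (minv a <= j)%N.
Proof.
move=> aj; rewrite /minv /fintype.arg_min /extremum.
case: pickP => [i /andP [/= ai /forallP H]|H] /=.
  by split=> //; apply: (implyP (H j)).
have [i ai imin] := @arg_minnP 'I_n.+1 j (fun i => a i != 0%N) (fun i => i : nat) aj.
move: (H i); rewrite /= ai /= => /negbT /negP []; apply/forallP => k.
by apply/implyP => /imin.
Qed.

Lemma minvU (i : 'I_n.+1) : minv U_(i)%MM = i.
Proof.
have : U_(i)%MM i != 0%N by rewrite mnm1E eqxx.
by case/minvP; rewrite mnm1E; case: (i =P _) => [<-|].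
Qed.

Lemma nonmult_minv a (i : 'I_n.+1) : ~~ nonmult a i -> (i <= minv a)%N.
Proof.
rewrite negb_exists => /forallP H.
case: (pselect (exists j, a j != 0%N)) => [[j /minvP [ma _]]|na].
  by move: (H (minv a)); rewrite ma /= -leqNgt.
rewrite /minv /fintype.arg_min /extremum; case: pickP => [k|_] /=.
  by case/andP => /= ak _; case: na; exists k.
by rewrite -ltnS.
Qed.

(** The reason why reductions terminate. If b is the larger one, let x_i be the
    largest variable in which a and b differ. As x_i occurs in b, it is
    multiplicative for t, so t contains no variable below x_i. Hence a + s = b + t
    gives a <= b in these variables as well, and s is a multiple of t by the
    multiplicative b - a. *)
Lemma mlex_cancel a b s t : (a + s)%MM = (b + t)%MM ->
  (forall i, nonmult t i -> b i = 0%N) ->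
  mlex b a \/ (a <= b)%MM /\ s = ((b - a) + t)%MM.
Proof.
move=> e mt.
suff : mlex b a \/ (a <= b)%MM.
  case=> [|ab]; [by left|right; split=> //].
  by apply: (@addmI _ a); rewrite addmA [(a + (b - a))%MM]addmC submK.
case: (mlex_total b a) => [|->|[i lti eqi]]; [by left|by right; exact: lepm_refl|].
right; apply/mnm_lepP => j; case: (ltngtP j i) => [ji|/eqi -> //|/val_inj ->].
  have tj : t j = 0%N.
    apply/eqP/negPn/negP => tj; have : nonmult t i by apply/existsP; exists j; rewrite tj.
    by move/mt => bi; rewrite bi in lti.
  by move/mnmP/(_ j): e; rewrite !mnmDE tj addn0 => <-; rewrite leq_addr.
exact: ltnW.
Qed.

End LexOrder.

(** * Linear algebra over the polynomial ring *)

Section Products.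
Variables (n : nat) (A : comNzRingType).
Implicit Types p q : {mpoly A[n]}.

Lemma mcoeffM_neq0 p q m : (p * q)@_m != 0 ->
  exists a b, [/\ m = (a + b)%MM, p@_a != 0 & q@_b != 0].
Proof.
move=> pq; apply: contrapT => H; move/eqP: pq; apply.
rewrite mcoeffM big1 // => k /eqP mk; apply/eqP/negPn/negP => nz; apply: H.
exists k.1, k.2; split=> //; apply: contraNneq nz => ->; by rewrite ?mul0r ?mulr0.
Qed.

Lemma mcoeffM_eq0 p q m :
  (forall a b, m = (a + b)%MM -> p@_a != 0 -> q@_b != 0 -> False) -> (p * q)@_m = 0.
Proof.
by move=> H; apply/eqP/negPn/negP => /mcoeffM_neq0 [a [b [/H]]].
Qed.

Lemma mcoeffXM p m k : ('X_[m] * p)@_(m + k) = p@_k.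
Proof. by rewrite mulrC mcoeffMX. Qed.

Lemma mcoeffM_uniq p q a0 b0 :
  (forall a b, (a0 + b0 = a + b)%MM -> p@_a != 0 -> q@_b != 0 -> a = a0) ->
  (p * q)@_(a0 + b0) = p@_a0 * q@_b0.
Proof.
move=> H; have -> : p * q = (p - p@_a0 *: 'X_[a0]) * q + p@_a0 *: ('X_[a0] * q).
  by rewrite scalerAl -mulrDl subrK.
rewrite mcoeffD mcoeffZ mcoeffXM mcoeffM_eq0 ?add0r // => a b e.
rewrite mcoeffB mcoeffZ mcoeffX; case: (eqVneq a0 a) => [<-|aa].
  by rewrite mulr1 subrr eqxx.
by rewrite mulr0 subr0 => pa qb; case/eqP: aa; rewrite (H _ _ e pa qb).
Qed.

End Products.

Section Vectors.
Variables (n : nat) (A : comNzRingType) (I : finType).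
Implicit Types (u v w : vec A n I) (p q : {mpoly A[n.+1]}) (t : term n I).

Lemma vscaleE p v k : vscale p v k = p * v k.
Proof. by rewrite ffunE. Qed.

Lemma mcoeff_vsub u v k a : ((u - v) k)@_a = (u k)@_a - (v k)@_a.
Proof. by rewrite ffunE mcoeffD [(- v) k]ffunE mcoeffN. Qed.

Lemma mcoeff_vopp u k a : ((- u) k)@_a = - (u k)@_a.
Proof. by rewrite ffunE mcoeffN. Qed.

Lemma lincombE (J : finType) (p : vec A n J) (F : J -> vec A n I) k :
  lincomb p F k = \sum_j p j * F j k.
Proof. by rewrite sum_ffunE; apply: eq_bigr => j _; rewrite vscaleE. Qed.

Lemma mcoeff_tvec t k a : (tvec A t k)@_a = ((a, k) == t)%:R.
Proof.
case: t => b l; rewrite ffunE xpair_eqE /= andbC.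
by case: eqP => _; rewrite ?mcoeff0 // mcoeffX eq_sym.
Qed.

Lemma tvec_neq0 t k a : (tvec A t k)@_a != 0 -> (a, k) = t.
Proof. by rewrite mcoeff_tvec; case: (_ =P t) => // _; rewrite mulr0n eqxx. Qed.

Lemma vscaleA p q v : vscale p (vscale q v) = vscale (p * q) v.
Proof. by apply/ffunP => k; rewrite !vscaleE mulrA. Qed.

Lemma vscaleDr p u v : vscale p (u + v) = vscale p u + vscale p v.
Proof. by apply/ffunP => k; rewrite !ffunE mulrDr. Qed.

Lemma vscaleDl p q v : vscale (p + q) v = vscale p v + vscale q v.
Proof. by apply/ffunP => k; rewrite !ffunE mulrDl. Qed.

Lemma vscaleBr p u v : vscale p (u - v) = vscale p u - vscale p v.
Proof. by apply/ffunP => k; rewrite !ffunE mulrBr. Qed.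

Lemma vscale0 p : vscale p 0 = 0 :> vec A n I.
Proof. by apply/ffunP => k; rewrite !ffunE mulr0. Qed.

Lemma vscale0l v : vscale 0 v = 0.
Proof. by apply/ffunP => k; rewrite !ffunE mul0r. Qed.

Lemma vscale1 v : vscale 1 v = v.
Proof. by apply/ffunP => k; rewrite !ffunE mul1r. Qed.

Lemma vscaleX a t : vscale 'X_[a] (tvec A t) = tvec A (tmul a t).
Proof.
by apply/ffunP => k; rewrite !ffunE /=; case: eqP; rewrite ?mulr0 // mpolyXD.
Qed.

Lemma vscale_sumr (T : finType) p (V : T -> vec A n I) (C : pred T) :
  vscale p (\sum_(i | C i) V i) = \sum_(i | C i) vscale p (V i).
Proof.
by apply/ffunP => k; rewrite vscaleE !sum_ffunE mulr_sumr; apply: eq_bigr => i _;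
   rewrite vscaleE.
Qed.

Lemma vec_expand v :
  v = \sum_k \sum_(a <- msupp (v k)) vscale ((v k)@_a)%:MP (tvec A (a, k)).
Proof.
apply/ffunP => k; rewrite sum_ffunE (bigD1 k) //= [X in _ + X]big1 => [|l lk].
  rewrite addr0 {1}[v k]mpolyE sum_ffunE; apply: eq_bigr => a _.
  by rewrite !ffunE /= eqxx mul_mpolyC.
rewrite sum_ffunE big1 // => a _.
by rewrite !ffunE /= eq_sym (negbTE lk) mulr0.
Qed.

Lemma vec_ind (Q : vec A n I -> Prop) v :
  Q 0 -> (forall u w, Q u -> Q w -> Q (u + w)) ->
  (forall k a, (v k)@_a != 0 -> Q (vscale ((v k)@_a)%:MP (tvec A (a, k)))) -> Q v.
Proof.
move=> Q0 QD QT; rewrite [v]vec_expand.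
apply: (big_ind Q) => // k _; rewrite big_seq.
by apply: (big_ind Q) => // a; rewrite mcoeff_msupp => /QT.
Qed.

Section Combinations.
Variable (J : finType).
Implicit Types (P R : vec A n J) (F : J -> vec A n I).

Lemma lincombD P R F : lincomb (P + R) F = lincomb P F + lincomb R F.
Proof.
by rewrite -big_split; apply: eq_bigr => j _; rewrite ffunE vscaleDl.
Qed.

Lemma lincombZ q P F : lincomb (vscale q P) F = vscale q (lincomb P F).
Proof.
by rewrite vscale_sumr; apply: eq_bigr => j _; rewrite vscaleA ffunE.
Qed.

Lemma lincomb0 F : lincomb 0 F = 0.
Proof. by rewrite /lincomb big1 // => j _; rewrite ffunE vscale0l. Qed.

Lemma lincombN P F : lincomb (- P) F = - lincomb P F.
Proof. by apply/eqP; rewrite -addr_eq0 -lincombD addNr lincomb0. Qed.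

Lemma lincombB P R F : lincomb (P - R) F = lincomb P F - lincomb R F.
Proof. by rewrite lincombD lincombN. Qed.

Lemma lincomb_tvec (t : term n J) F : lincomb (tvec A t) F = vscale 'X_[t.1] (F t.2).
Proof.
rewrite /lincomb (bigD1 t.2) //= big1 => [|j jt]; rewrite ffunE ?eqxx ?addr0 //.
by rewrite (negbTE jt) vscale0l.
Qed.

Lemma eq_lincomb P F F' : F =1 F' -> lincomb P F = lincomb P F'.
Proof. by move=> e; apply: eq_bigr => j _; rewrite e. Qed.

Lemma mspan_gen F j : mspan F (F j).
Proof. by exists (tvec A (0%MM, j)); rewrite lincomb_tvec mpolyX0 vscale1. Qed.

Lemma mspan_submod F : is_submod (mspan F).
Proof.
split=> [|u v [p ->] [q ->]|q v [p ->]].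
- by exists 0; rewrite lincomb0.
- by exists (p + q); rewrite lincombD.
- by exists (vscale q p); rewrite lincombZ.
Qed.

Lemma submodN (M : vec A n I -> Prop) v : is_submod M -> M v -> M (- v).
Proof.
case=> _ _ MZ /(MZ (-1)); rewrite (_ : vscale _ _ = - v) //.
by apply/ffunP => k; rewrite !ffunE mulN1r.
Qed.

Lemma mspan_min (M : vec A n I -> Prop) F v :
  is_submod M -> (forall j, M (F j)) -> mspan F v -> M v.
Proof.
case=> M0 MD MZ MF [p ->]; apply: (big_ind M) => // j _; exact: MZ.
Qed.

Lemma syz_submod F : is_submod (syz F).
Proof.
split=> [|u v su sv|q v sv]; rewrite /syz ?lincomb0 //.
- by rewrite lincombD su sv addr0.
- by rewrite lincombZ sv vscale0.
Qed.

End Combinations.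

(** The coefficient of t in a combination of the generators is a sum of products,
    one of which has to be nonzero; this one exhibits a generator dividing t. *)
Lemma mspan_terms (S : seq (term n I)) t :
  mspan (fun s : seq_sub S => tvec A (val s)) (tvec A t) <->
  exists2 s, s \in S & exists a, t = tmul a s.
Proof.
split=> [[p e]|[s sS [a ->]]]; last first.
  have [_ _ MZ] := mspan_submod (fun s : seq_sub S => tvec A (val s)).
  by rewrite -vscaleX; apply: MZ; apply: (mspan_gen _ (SeqSub sS)).
case: t e => m k /ffunP /(_ k) /(congr1 (mcoeff m)).
rewrite mcoeff_tvec eqxx lincombE; apply: contraPP => H.
rewrite raddf_sum big1 /=; first by move/eqP; rewrite oner_eq0.
move=> s _; apply: mcoeffM_eq0 => a b e _ /tvec_neq0 bs; apply: H.
by exists (b, k); [rewrite bs; exact: valP | exists a; rewrite e].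
Qed.

End Vectors.

(** * Base change *)

Section BaseChange.
Variables (n : nat) (A B : comNzRingType) (I : finType) (phi : {rmorphism A -> B}).
Implicit Types (u v w : vec A n I).

Lemma vmap0 : vmap phi (0 : vec A n I) = 0.
Proof. by apply/ffunP => k; rewrite !ffunE rmorph0. Qed.

Lemma vmapD u v : vmap phi (u + v) = vmap phi u + vmap phi v.
Proof. by apply/ffunP => k; rewrite !ffunE rmorphD. Qed.

Lemma vmapB u v : vmap phi (u - v) = vmap phi u - vmap phi v.
Proof. by apply/ffunP => k; rewrite !ffunE rmorphB. Qed.

Lemma vmap_sum (T : finType) (C : pred T) (V : T -> vec A n I) :
  vmap phi (\sum_(i | C i) V i) = \sum_(i | C i) vmap phi (V i).
Proof. by apply: big_morph; [exact: vmapD | exact: vmap0]. Qed.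

Lemma vmapZ p v : vmap phi (vscale p v) = vscale (map_mpoly phi p) (vmap phi v).
Proof. by apply/ffunP => k; rewrite !ffunE rmorphM. Qed.

Lemma vmap_tvec t : vmap phi (tvec A t : vec A n I) = tvec B t.
Proof.
by apply/ffunP => k; rewrite !ffunE; case: eqP => _; rewrite ?rmorph0 ?map_mpolyX.
Qed.

Lemma mcoeff_vmap v k a : (vmap phi v k)@_a = phi (v k)@_a.
Proof. by rewrite ffunE mcoeff_map_mpoly. Qed.

Lemma vmap_lincomb (J : finType) (p : vec A n J) (F : J -> vec A n I) :
  vmap phi (lincomb p F) = lincomb (vmap phi p) (fun j => vmap phi (F j)).
Proof.
by rewrite vmap_sum; apply: eq_bigr => j _; rewrite vmapZ ffunE.
Qed.

Lemma extend_mspan (J : finType) (F : J -> vec A n I) (w : vec B n I) :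
  extend phi (mspan F) w <-> mspan (fun j => vmap phi (F j)) w.
Proof.
split=> [[s [sF]]|].
  apply: mspan_min; first exact: mspan_submod.
  move=> i; have /sF [p ->] : nth 0 s i \in s by apply: mem_nth.
  by exists (vmap phi p); rewrite vmap_lincomb.
move=> Fw; exists [seq F j | j <- enum J]; split.
  by move=> _ /mapP [j _ ->]; exact: mspan_gen.
apply: mspan_min Fw; first exact: mspan_submod.
move=> j; have jlt : (index j (enum J) < size [seq F j | j <- enum J])%N.
  by rewrite size_map index_mem mem_enum.
have := mspan_gen (fun i : 'I__ => vmap phi (nth 0 [seq F j | j <- enum J] i)) (Ordinal jlt).
by rewrite /= (nth_map j) ?nth_index ?mem_enum // -(size_map F).
Qed.

End BaseChange.

Lemma eq_extend n (A B : comNzRingType) (I : finType) (phi : {rmorphism A -> B})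
    (M M' : vec A n I -> Prop) (w : vec B n I) :
  (forall v, M v <-> M' v) -> extend phi M w <-> extend phi M' w.
Proof.
by move=> e; split=> -[s [sM h]]; exists s; split=> // v /sM /e.
Qed.

(** * Pommaret bases *)

Section PommaretBasis.
Variables (K : fieldType) (n : nat) (L : level K n).
Hypothesis UP : pommaret_basis (@lU K n L) (lpom L).
Notation I := (lidx L).
Notation S := (seq_sub (lpom L)).
Implicit Types (t : term n I) (s : S) (a b : 'X_{1..n.+1}).

Definition mult a s : Prop := forall i, nonmult (val s).1 i -> a i = 0%N.

Lemma coneP s t : cone (val s) t <-> exists2 a, mult a s & t = tmul a (val s).
Proof. by split=> -[a h1 h2]; exists a. Qed.

Lemma tmul_inj a b t : tmul a t = tmul b t -> a = b.
Proof. by move/(congr1 fst)/addIm. Qed.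

Lemma tmul_eq a b t t' :
  tmul a t = tmul b t' -> (a + t.1)%MM = (b + t'.1)%MM /\ t.2 = t'.2.
Proof. by move=> e; split; [exact: (congr1 fst e) | exact: (congr1 snd e)]. Qed.

Lemma cone_mult a s : cone (val s) (tmul a (val s)) <-> mult a s.
Proof.
by split=> [[b /tmul_inj ->]|ha] //; exists a.
Qed.

Lemma lU_cone t : lU (tvec K t) <-> exists a s, mult a s /\ t = tmul a (val s).
Proof.
case: UP => _ _ UC _; split=> [/UC [s sP /(@coneP (SeqSub sP)) [a ma ->]]|[a [s [ma ->]]]].
  by exists a, (SeqSub sP).
by apply/UC; exists (val s); [exact: valP | apply/coneP; exists a].
Qed.

Lemma lU_tmul a t : lU (tvec K t) -> lU (tvec K (tmul a t)).
Proof.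
case: UP => _ US _ _ /US h; apply/US; rewrite -vscaleX.
by case: (mspan_submod (fun s : S => tvec K (val s))) => _ _; apply.
Qed.

Lemma lU_pom s : lU (tvec K (val s)).
Proof.
apply/lU_cone; exists 0%MM, s; split=> [i _|]; first by rewrite mnm0E.
by rewrite /tmul add0m -surjective_pairing.
Qed.

Lemma cone_uniq a b s s' : mult a s -> mult b s' ->
  tmul a (val s) = tmul b (val s') -> a = b /\ s = s'.
Proof.
move=> ma mb e; case: UP => _ _ _ UU.
have ss : s = s'.
  apply: val_inj; apply: (UU _ _ (tmul a (val s))); try exact: valP.
    by apply/cone_mult.
  by rewrite e; apply/cone_mult.
by subst s'; split=> //; apply: tmul_inj e.
Qed.

(** When a multiple of a term outside U falls into U, its multiplier decreases on
    passing to the cone decomposition: otherwise the term itself would lie in the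
    cone of s. *)
Lemma mlex_inN a b s t : inN t -> mult b s -> tmul a t = tmul b (val s) -> mlex b a.
Proof.
move=> Nt mb /tmul_eq [e1 e2]; case: (mlex_cancel e1 mb) => // -[ab e].
case: Nt; apply/lU_cone; exists (b - a)%MM, s; split.
  by move=> i /mb bi; rewrite mnmBE bi.
by case: t e1 e2 e => t1 t2 /= _ -> ->.
Qed.

(** Similarly for a non-multiplicative multiple of s': if b were not smaller than
    x_i, then s' would lie in the cone of s, hence s' = s and b = x_i, against
    the non-multiplicativity of x_i. *)
Lemma mlex_nonmult (i : 'I_n.+1) b s s' : nonmult (val s').1 i -> mult b s ->
  tmul U_(i)%MM (val s') = tmul b (val s) -> mlex b U_(i)%MM.
Proof.
move=> ni mb /tmul_eq [e1 e2]; case: (mlex_cancel e1 mb) => // -[ab e].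
have mab : mult (b - U_(i))%MM s by move=> j /mb bj; rewrite mnmBE bj.
have m0 : mult 0%MM s' by move=> j _; rewrite mnm0E.
have e' : tmul (b - U_(i))%MM (val s) = tmul 0%MM (val s').
  by rewrite /tmul -e e2 add0m.
have [z ss] := cone_uniq mab m0 e'; subst s'.
have := mb i ni; have := mnm_lepP ab i; rewrite mnm1E eqxx => + bi.
by rewrite bi.
Qed.

End PommaretBasis.

Section NextLevel.
Variables (K : fieldType) (n : nat) (L : level K n).
Notation S := (seq_sub (lpom L)).

Lemma next_pomP (t : term n S) :
  reflect (exists2 i, t.1 = U_(i)%MM & nonmult (val t.2).1 i) (t \in next_pom L).
Proof.
apply: (iffP mapP) => [[[s i]]|[i ti ni]].
  by rewrite mem_filter /= => /andP [ni _] ->; exists i.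
exists (t.2, i); first by rewrite mem_filter /= ni mem_enum.
by case: t ti ni => a s /= ->.
Qed.

Lemma next_pom_cone (i : 'I_n.+1) (s : S) (t : term n S) :
  cone (U_(i)%MM, s) t <->
  [/\ t.2 = s, t.1 i != 0%N & forall j : 'I_n.+1, (i < j)%N -> t.1 j = 0%N].
Proof.
split=> [[a -> ha]|[ts ti tj]].
  split=> //= [|j ij]; first by rewrite mnmDE mnm1E eqxx addn1.
  by rewrite mnmDE ha /= ?nonmultU // mnm1E -val_eqE (ltn_eqF ij).
case: t ts ti tj => b r /= -> bi bj; exists (b - U_(i))%MM.
  by rewrite /tmul /= submK // lep1mP.
by move=> j; rewrite nonmultU => ij; rewrite mnmBE bj.
Qed.

(** Non-multiplicative variables are closed upwards. Hence a term x^a f_s that is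
    divisible by some non-multiplicative x_i f_s is also divisible by x_j f_s for
    the largest variable x_j of x^a, and it lies in the cone of this one and of no
    other generator. *)
Lemma next_pommaret : pommaret_basis (@lU K n (next L)) (lpom (next L)).
Proof.
split=> [|//||].
- rewrite /= map_inj_in_uniq ?filter_uniq -?enumT ?enum_uniq //.
  move=> [s i] [s' i'] _ _ /= e; have /= -> := congr1 snd e.
  by have /= /eqP := congr1 fst e; rewrite eq_mnm1 => /eqP ->.
- move=> t; split=> [/mspan_terms [s sN [a ->]]|[s sN [a -> _]]]; last first.
    by apply/mspan_terms; exists s => //; exists a.
  case/next_pomP: sN => i si ni.
  have ti : (a + s.1)%MM i != 0%N by rewrite si mnmDE mnm1E eqxx addn1.
  pose j := [arg max_(j > i | (a + s.1)%MM j != 0%N) (j : nat)].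
  have [tj jmax] : (a + s.1)%MM j != 0%N /\
      forall k, (a + s.1)%MM k != 0%N -> (k <= j)%N.
    by rewrite /j; case: arg_maxnP.
  exists (U_(j)%MM, s.2).
    by apply/next_pomP; exists j => //; apply: nonmult_trans ni; apply: jmax.
  apply/next_pom_cone; split=> //= k jk; apply/eqP/negPn/negP => /jmax.
  by rewrite leqNgt jk.
move=> [a s] [a' s'] t /next_pomP [i /= -> _] /next_pomP [i' /= -> _].
move=> /next_pom_cone [ts ti tj] /next_pom_cone [ts' ti' tj'].
rewrite -ts -ts'; congr (U_(_)%MM, _); apply: val_inj.
case: (ltngtP i i') => // ii.
- by rewrite tj in ti'.
- by rewrite tj' in ti.
Qed.

(** This identification turns normal forms modulo U^(1) into the combinations
    whose multipliers are multiplicative, to which uniqueness of writings applies. *)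
Lemma inN_next a (s : S) : inN (L := next L) (a, s) <-> mult a s.
Proof.
split=> [Nt i ni|mt]; last first.
  move/mspan_terms => [s' /next_pomP [i si ni] [b e]].
  have [e1 e2] : a = (b + s'.1)%MM /\ s = s'.2.
    by split; [exact: (congr1 fst e) | exact: (congr1 snd e)].
  have := mt i; rewrite e2 => /(_ ni); rewrite e1 mnmDE si mnm1E eqxx.
  by rewrite addn1.
apply/eqP/negPn/negP => ti; apply: Nt; apply/mspan_terms.
exists (U_(i)%MM, s); first by apply/next_pomP; exists i.
by exists (a - U_(i))%MM; rewrite /tmul /= submK ?lep1mP.
Qed.

End NextLevel.

(** * Writings with respect to a marked set *)

Lemma tdeg_tmul n (I : finType) (deg : I -> int) a (t : term n I) :
  tdeg deg (tmul a t) = (mdeg a)%:Z + tdeg deg t.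
Proof. by rewrite /tdeg /= mdegD PoszD addrA. Qed.

Section MarkedSets.
Variables (K : fieldType) (n : nat) (L : level K n).
Hypothesis UP : pommaret_basis (@lU K n L) (lpom L).
Variables (A : comNzRingType) (F : fam A L).
Hypothesis FM : marked_set F.
Notation I := (lidx L).
Notation S := (seq_sub (lpom L)).
Notation td := (tdeg (ldeg L)).
Implicit Types (t : term n I) (s : S) (a b : 'X_{1..n.+1}) (f g : vec A n I)
  (P : vec A n S) (Q : 'X_{1..n.+1} -> S -> Prop).

Lemma marked_tail s a k : (F s k)@_a != 0 -> (a, k) <> val s -> inN (L := L) (a, k).
Proof.
move=> fs ne; have [_ _ sN] := FM s; apply: sN.
by rewrite mcoeff_vsub mcoeff_tvec; case: (_ =P val s) => // _; rewrite subr0.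
Qed.

Lemma marked_homog s : is_homog (ldeg L) (td (val s)) (F s).
Proof.
have [[e he] h1 _] := FM s.
by have := he (val s).2 (val s).1; rewrite h1 oner_neq0 -surjective_pairing => ->.
Qed.

Lemma spanN0 : spanN (L := L) (0 : vec A n I).
Proof. by move=> k a; rewrite ffunE mcoeff0 eqxx. Qed.

Lemma spanND f g : spanN (L := L) f -> spanN (L := L) g -> spanN (L := L) (f + g).
Proof.
move=> hf hg k a; rewrite ffunE mcoeffD.
case: (eqVneq (f k)@_a 0) => [->|/hf //]; rewrite add0r; exact: hg.
Qed.

Lemma spanNZ p f : spanN (L := L) f -> spanN (L := L) (vscale p%:MP f).
Proof.
move=> hf k a; rewrite vscaleE mcoeffCM => nz; apply: hf.
by apply: contraNneq nz => ->; rewrite mulr0.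
Qed.

Lemma spanN_tvec t : inN (L := L) t -> spanN (L := L) (tvec A t).
Proof. by move=> Nt k a /tvec_neq0 ->. Qed.

Definition supp Q P : Prop := forall s a, (P s)@_a != 0 -> Q a s.

Lemma supp0 Q : supp Q 0.
Proof. by move=> s a; rewrite ffunE mcoeff0 eqxx. Qed.

Lemma suppD Q P P' : supp Q P -> supp Q P' -> supp Q (P + P').
Proof.
move=> hP hP' s a; rewrite ffunE mcoeffD.
case: (eqVneq (P s)@_a 0) => [->|/hP //]; rewrite add0r; exact: hP'.
Qed.

Lemma suppN Q P : supp Q P -> supp Q (- P).
Proof. by move=> h s a; rewrite ffunE mcoeffN oppr_eq0; apply: h. Qed.

Lemma suppZ Q (c : A) P : supp Q P -> supp Q (vscale c%:MP P).
Proof.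
move=> hP s a; rewrite vscaleE mcoeffCM => nz; apply: hP.
by apply: contraNneq nz => ->; rewrite mulr0.
Qed.

Lemma supp_tvec Q (t : term n S) : Q t.1 t.2 -> supp Q (tvec A t).
Proof. by move=> h s a /tvec_neq0 e; move: h; rewrite -e. Qed.

Lemma writingE f P g : writing F f P g <->
  [/\ supp (@mult K n L) P, spanN g & f = lincomb P F + g].
Proof.
by split=> -[h1 h2 h3]; split=> // s a /h1 /cone_mult.
Qed.

(** The predicate on multipliers records the properties of a writing that the
    reduction process guarantees and that are then transported to every writing
    by uniqueness. *)
Definition writable Q f : Prop := exists P g,
  writing F f P g /\ supp Q P.

Lemma writable_sub Q Q' f : (forall a s, Q a s -> Q' a s) -> writable Q f -> writable Q' f.
Proof. by move=> h [P [g [w q]]]; exists P, g; split=> // s a /q /h. Qed.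

Lemma writable0 Q : writable Q 0.
Proof.
exists 0, 0; split; last exact: supp0.
by apply/writingE; split; [exact: supp0|exact: spanN0|rewrite lincomb0 addr0].
Qed.

Lemma writableD Q f f' : writable Q f -> writable Q f' -> writable Q (f + f').
Proof.
move=> [P [g [/writingE [m N ->] q]]] [P' [g' [/writingE [m' N' ->] q']]].
exists (P + P'), (g + g'); split; last exact: suppD.
apply/writingE; split; [exact: suppD|exact: spanND|].
by rewrite lincombD addrACA.
Qed.

Lemma writableZ Q (c : A) f : writable Q f -> writable Q (vscale c%:MP f).
Proof.
move=> [P [g [/writingE [m N ->] q]]].
exists (vscale c%:MP P), (vscale c%:MP g); split; last exact: suppZ.
apply/writingE; split; [exact: suppZ|exact: spanNZ|].
by rewrite lincombZ vscaleDr.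
Qed.

Lemma writable_scaleX Q a f :
  (forall k b, (f k)@_b != 0 -> writable Q (tvec A (tmul a (b, k)))) ->
  writable Q (vscale 'X_[a] f).
Proof.
move=> h; apply: (@vec_ind _ _ _ (fun u => writable Q (vscale 'X_[a] u))).
- by rewrite vscale0; exact: writable0.
- by move=> u w hu hw; rewrite vscaleDr; exact: writableD.
- by move=> k b /h; rewrite vscaleA mulrC -vscaleA vscaleX; exact: writableZ.
Qed.

Lemma writable_tvec Q f :
  (forall k b, (f k)@_b != 0 -> writable Q (tvec A (b, k))) -> writable Q f.
Proof.
move=> h; rewrite -[f]vscale1 -mpolyX0; apply: writable_scaleX => k b /h.
by rewrite /tmul add0m.
Qed.

Lemma writable_inN_tvec Q t : inN t -> writable Q (tvec A t).
Proof.
move=> Nt; exists 0, (tvec A t); split; last exact: supp0.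
apply/writingE; split; [exact: supp0|exact: spanN_tvec|].
by rewrite lincomb0 add0r.
Qed.

(** One reduction step replaces the head x^a s by the terms x^a t, where t runs
    through the tail of F_s. *)
Lemma writable_step Q a s : mult a s -> Q a s ->
  (forall t, inN t -> td t = td (val s) -> writable Q (tvec A (tmul a t))) ->
  writable Q (tvec A (tmul a (val s))).
Proof.
move=> ma qa h.
have -> : tvec A (tmul a (val s)) =
    lincomb (tvec A (a, s)) F + vscale (-1)%:MP (vscale 'X_[a] (F s - tvec A (val s))).
  rewrite lincomb_tvec /= vscaleBr vscaleX mpolyCN.
  apply/ffunP => k; rewrite !ffunE mulN1r opprB addrC subrK //.
apply: writableD.
  exists (tvec A (a, s)), 0; split; last exact: supp_tvec.
  by apply/writingE; split; [exact: supp_tvec|exact: spanN0|rewrite addr0].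
apply/writableZ/writable_scaleX => k b nz.
have [_ _ /(_ k b nz) Nb] := FM s.
apply: h => //; apply: (marked_homog (s := s)); move: nz; rewrite mcoeff_vsub mcoeff_tvec.
case: (_ =P val s) => [e|]; last by rewrite subr0.
by case: Nb; rewrite e; exact: lU_pom.
Qed.

(** Termination of the reduction: along the tails the multipliers strictly
    decrease for the lexicographic order. *)
Lemma writable_inN e t : inN t ->
  writable (fun a s => mlex a e /\ td (tmul a (val s)) = td (tmul e t))
    (tvec A (tmul e t)).
Proof.
elim/(@mlex_ind n): e t => e IH t Nt.
case: (pselect (lU (tvec K (tmul e t)))) => [|Ne]; last exact: writable_inN_tvec.
move/(lU_cone UP) => [a [s [ma et]]].
have ae : mlex a e := mlex_inN UP Nt ma et.
rewrite et; apply: writable_step => // t' Nt' dt'.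
apply: writable_sub (IH _ ae _ Nt') => b s' [ba ->]; split.
  exact: mlex_trans ae.
by rewrite !tdeg_tmul dt'.
Qed.

Lemma writable_term t : writable (fun a s => td (tmul a (val s)) = td t) (tvec A t).
Proof.
case: (pselect (lU (tvec K t))) => [|Nt]; last exact: writable_inN_tvec.
move/(lU_cone UP) => [a [s [ma ->]]]; apply: writable_step => // t' Nt' dt'.
by apply: writable_sub (writable_inN a Nt') => b s' [_ ->]; rewrite !tdeg_tmul dt'.
Qed.

Lemma writing_exists f : exists P g, writing F f P g.
Proof.
have [P [g [w _]]] : writable (fun _ _ => True) f; last by exists P, g.
by apply: writable_tvec => k b _; apply: writable_sub (writable_term _).
Qed.

(** The bound on the multipliers is what confines the terms of fundamental
    syzygies to finitely many prescribed ones; it also makes the rewriting in the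
    criterion below terminate. *)
Lemma writable_nonmult (i : 'I_n.+1) s : nonmult (val s).1 i ->
  writable (fun a s' => mlex a U_(i)%MM /\
                        td (tmul a (val s')) = td (tmul U_(i)%MM (val s)))
    (vscale 'X_i (F s)).
Proof.
move=> ni; apply: writable_scaleX => k b nz.
have db : td (b, k) = td (val s) := marked_homog nz.
case: (pselect ((b, k) = val s)) => [->|ne]; last first.
  apply: writable_sub (writable_inN U_(i)%MM (marked_tail nz ne)) => a s' [la ->].
  by split=> //; rewrite !tdeg_tmul db.
have : lU (tvec K (tmul U_(i)%MM (val s))) by apply/(lU_tmul UP)/(lU_pom UP).
move/(lU_cone UP) => [a [s' [ma e]]].
have la : mlex a U_(i)%MM := mlex_nonmult UP ni ma e.
rewrite e; apply: writable_step => // t' Nt' dt'.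
apply: writable_sub (writable_inN a Nt') => c s'' [ca ->]; split.
  exact: mlex_trans la.
by rewrite !tdeg_tmul dt'.
Qed.

(** The head x^a s with the largest multiplier a cannot be cancelled: heads have
    pairwise distinct positions because cones are disjoint, and by mlex_inN a tail
    term at this position would come with a multiplier larger than a. *)
Lemma mult_lincomb_eq0 P g :
  supp (@mult K n L) P -> spanN g -> lincomb P F + g = 0 -> P = 0.
Proof.
move=> mP Ng e; apply: contrapT => P0.
have [[s0 a0] nz0] : exists x : S * 'X_{1..n.+1}, (P x.1)@_x.2 != 0.
  apply: contrapT => H; apply: P0; apply/ffunP => s; apply/mpolyP => a.
  rewrite ffunE mcoeff0; apply/eqP/negPn/negP => nz; apply: H; by exists (s, a).
pose supps := [seq (s, a) | s <- enum {: S}, a <- msupp (P s)].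
have memP s a : (s, a) \in supps = ((P s)@_a != 0).
  rewrite -mcoeff_msupp; apply/allpairsPdep/idP => [[s' [a' [_ h [-> ->]]]] //|h].
  by exists s, a; rewrite mem_enum.
have x0 : (s0, a0) \in supps by rewrite memP.
have [[s a]] := mlex_max (fun x : S * 'X_{1..n.+1} => x.2) x0.
rewrite memP => nz amax.
have ma : mult a s := mP _ _ nz.
have contrib s' b c : (P s')@_b != 0 -> (F s' (val s).2)@_c != 0 ->
    (a + (val s).1)%MM = (b + c)%MM -> b = a /\ s' = s.
  move=> nzb nzc ebc.
  have et : tmul b (c, (val s).2) = tmul a (val s) by rewrite /tmul ebc.
  case: (pselect ((c, (val s).2) = val s')) => [ec|ne].
    by apply: (cone_uniq UP (mP _ _ nzb) ma); rewrite -et ec.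
  have := mlex_inN UP (marked_tail nzc ne) ma et.
  by have := amax (s', b); rewrite memP => /(_ nzb) /= h /h.
have := congr1 (fun v : vec A n I => (v (val s).2)@_(a + (val s).1)) e.
rewrite ffunE mcoeffD lincombE raddf_sum (bigD1 s) //= big1 => [|s' ss].
  rewrite mcoeffM_uniq => [|b c ebc nzb nzc]; last first.
    by case: (contrib s b c nzb nzc ebc).
  have [_ -> _] := FM s; rewrite mulr1 addr0 ffunE mcoeff0.
  case: (eqVneq (g (val s).2)@_(a + (val s).1) 0) => [->|/Ng Nt].
    by rewrite addr0 => h; rewrite h eqxx in nz.
  by case: Nt; apply/(lU_cone UP); exists a, s.
apply: mcoeffM_eq0 => b c ebc nzb nzc; case/eqP: ss.
by case: (contrib s' b c nzb nzc ebc).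
Qed.

Lemma writing_uniq f P g P' g' :
  writing F f P g -> writing F f P' g' -> P = P' /\ g = g'.
Proof.
move=> /writingE [mP Ng ->] /writingE [mP' Ng' e].
have Ngg : spanN (g - g').
  apply: spanND => // k a; rewrite ffunE mcoeffN oppr_eq0; exact: Ng'.
have PP : P - P' = 0.
  apply: (mult_lincomb_eq0 (suppD mP (suppN mP')) Ngg).
  by rewrite lincombB addrACA e -opprD subrr.
move/eqP: PP; rewrite subr_eq0 => /eqP PP; subst P'; split=> //.
exact: addrI e.
Qed.

Lemma writing_supp Q f P g : writable Q f -> writing F f P g -> supp Q P.
Proof. by move=> [P' [g' [w' q]]] /writing_uniq /(_ w') [->]. Qed.

Lemma marked_basis_writing f P g : marked_basis F ->
  writing F f P g -> mspan F f -> g = 0.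
Proof.
move=> [_ [_ disj]] [_ Ng e] Ff; apply: disj => //.
have [_ MD _] := mspan_submod F.
have -> : g = f - lincomb P F by rewrite e addrC addKr.
apply: MD => //; apply: submodN; [exact: mspan_submod | by exists P].
Qed.

(** The combinations with multiplicative multipliers form a submodule: a
    non-multiplicative x_i in x^a F_s can be traded, by the given writing of
    x_i F_s, for multipliers that are smaller than a. By mult_lincomb_eq0 such a
    combination is not in the span of N(U), unless it is 0. *)
Lemma marked_basis_criterion :
  (forall s i, nonmult (val s).1 i -> exists P, writing F (vscale 'X_i (F s)) P 0) ->
  marked_basis F.
Proof.
move=> H; split=> //.
pose W f := exists2 P, supp (@mult K n L) P & f = lincomb P F.
have W0 : W 0 by exists 0; [exact: supp0|rewrite lincomb0].
have WD f g : W f -> W g -> W (f + g).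
  by move=> [P mP ->] [R mR ->]; exists (P + R); [exact: suppD|rewrite lincombD].
have WZ (c : A) f : W f -> W (vscale c%:MP f).
  by move=> [P mP ->]; exists (vscale c%:MP P); [exact: suppZ|rewrite lincombZ].
have WX a : forall s, W (vscale 'X_[a] (F s)).
  elim/(@mlex_ind n): a => a IH s.
  case: (pselect (mult a s)) => [ma|].
    by exists (tvec A (a, s)); [exact: supp_tvec|rewrite lincomb_tvec].
  rewrite /mult -existsNE => -[i]; rewrite not_implyE => -[ni /eqP ai].
  have [P wP] := H s i ni.
  have lP := writing_supp (writable_nonmult ni) wP.
  case: wP => _ _; rewrite addr0 => eP.
  have ea : (a = (a - U_(i)) + U_(i))%MM by rewrite submK // lep1mP.
  rewrite ea mpolyXD -vscaleA eP -lincombZ.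
  have -> : vscale 'X_[a - U_(i)] P =
      \sum_s \sum_(b <- msupp (P s)) vscale ((P s)@_b)%:MP (tvec A ((a - U_(i)) + b, s)%MM).
    rewrite {1}[P]vec_expand vscale_sumr; apply: eq_bigr => s' _.
    rewrite (big_morph (vscale 'X_[a - U_(i)]) (vscaleDr _) (vscale0 _ _)).
    by apply: eq_bigr => b _; rewrite vscaleA mulrC -vscaleA vscaleX.
  (* all multipliers b + (a - x_i) that occur are smaller than a, since b < x_i *)
  have lin := big_morph (fun R => lincomb R F) (fun R R' => lincombD R R' F) (lincomb0 F).
  rewrite lin; apply: (big_ind W) => // s' _.
  rewrite lin big_seq; apply: (big_ind W) => // b.
  rewrite mcoeff_msupp => /lP [lb _]; rewrite lincombZ lincomb_tvec /=.
  by apply: WZ; apply: IH; rewrite {2}ea; apply: mlexD2l.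
split=> [v|v [p ->] Nv].
  have [P [g [_ Ng ->]]] := writing_exists v.
  by exists (lincomb P F), g; split=> //; exists P.
have [P mP e] : W (lincomb p F).
  apply: (big_ind W) => // s _; rewrite [p s]mpolyE.
  have -> : vscale (\sum_(m <- msupp (p s)) (p s)@_m *: 'X_[m]) (F s) =
     \sum_(m <- msupp (p s)) vscale ((p s)@_m)%:MP (vscale 'X_[m] (F s)).
    rewrite (big_morph (fun q => vscale q (F s)) (fun q r => vscaleDl q r _) (vscale0l _)).
    by apply: eq_bigr => m _; rewrite vscaleA mul_mpolyC.
  by apply: (big_ind W) => // m _; apply: WZ.
have N2 : spanN (- lincomb p F).
  by move=> k a; rewrite ffunE mcoeffN oppr_eq0; apply: Nv.
have := mult_lincomb_eq0 mP N2; rewrite -e subrr => /(_ erefl) P0.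
by rewrite e P0 lincomb0.
Qed.

End MarkedSets.

(** * Fundamental syzygies *)

Section FundamentalSyzygies.
Variables (K : fieldType) (n : nat) (L : level K n).
Hypothesis UP : pommaret_basis (@lU K n L) (lpom L).
Variables (A : comNzRingType) (F : fam A L).
Hypothesis FB : marked_basis F.
Notation S := (seq_sub (lpom L)).
Let FM : marked_set F := FB.1.

Lemma next_pomE (c : seq_sub (lpom (next L))) :
  exists i (s : S), val c = (U_(i)%MM, s) /\ nonmult (val s).1 i.
Proof.
have /next_pomP [i ci ni] := valP c.
by exists i, (val c).2; rewrite -ci -surjective_pairing.
Qed.

Lemma fund_syz_exists : exists G : fam A (next L), fund_syz F G.
Proof.
suff [P wP] : exists P : seq_sub (lpom (next L)) -> vec A n S,
    forall c, writing F (lincomb (tvec A (val c)) F) (P c) 0.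
  by exists (fun c => tvec A (val c) - P c) => c; exists (P c).
apply: (@fin_all_exists _ _ (fun c P => writing F (lincomb (tvec A (val c)) F) P 0)) => c; have [P [g w]] := writing_exists UP FM (lincomb (tvec A (val c)) F).
by exists P; rewrite -(marked_basis_writing FB w) //; exists (tvec A (val c)).
Qed.

Lemma fund_syz_uniq (G G' : fam A (next L)) : fund_syz F G -> fund_syz F G' -> G =1 G'.
Proof.
move=> GF GF' c; have [P w ->] := GF c; have [P' w' ->] := GF' c.
by rewrite (writing_uniq UP FM w w').1.
Qed.

Lemma fund_syz_lincomb (G : fam A (next L)) c : fund_syz F G -> lincomb (G c) F = 0.
Proof.
by move=> /(_ c) [P [_ _ e] ->]; rewrite lincombB e addr0 subrr.
Qed.

(** A syzygy with head x_i f_s is fundamental as soon as its tail has multiplicative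
    multipliers, because it then is the writing of x_i F_s. This is how the
    equations M_t M_(t+1) = 0 are interpreted. *)
Lemma fund_syzI (G : fam A (next L)) :
  (forall c, spanN (L := next L) (G c - tvec A (val c))) ->
  (forall c, lincomb (G c) F = 0) -> fund_syz F G.
Proof.
move=> GN G0 c; exists (tvec A (val c) - G c); last by rewrite opprB addrC subrK.
apply/writingE; split; [|exact: spanN0|by rewrite lincombB G0 subr0 addr0].
move=> s a; rewrite -[tvec A (val c) - G c]opprK [- (_ - G c)]opprB mcoeff_vopp oppr_eq0.
by move/(GN c)/inN_next.
Qed.

(** Together these conditions place every tail term among those that carry a
    parameter B. *)
Lemma fund_syz_tail (G : fam A (next L)) c s a : fund_syz F G ->
  ((G c - tvec A (val c)) s)@_a != 0 ->
  [/\ inN (L := next L) (a, s), mlex a (val c).1 &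
      tdeg (ldeg (next L)) (a, s) = tdeg (ldeg (next L)) (val c)].
Proof.
move=> /(_ c) [P w ->]; rewrite addrAC subrr add0r ffunE mcoeffN oppr_eq0 => nz.
have [i [r [cE ni]]] := next_pomE c.
move: w; rewrite cE lincomb_tvec /= => w.
have [la da] := writing_supp UP FM (writable_nonmult UP FM ni) w nz.
move/writingE: w => [mP _ _]; split=> //; first by apply/inN_next; exact: mP nz.
by move: da; rewrite !tdeg_tmul.
Qed.

Lemma fund_syz_marked (G : fam A (next L)) : fund_syz F G -> marked_set G.
Proof.
move=> GF c.
have tail s a : ((G c) s)@_a != 0 -> (a, s) <> val c -> ((G c - tvec A (val c)) s)@_a != 0.
  by rewrite mcoeff_vsub mcoeff_tvec; case: (_ =P val c) => // _; rewrite subr0.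
split.
- exists (tdeg (ldeg (next L)) (val c)) => s a nz.
  case: (pselect ((a, s) = val c)) => [->//|ne].
  by have [] := fund_syz_tail GF (tail s a nz ne).
- have := @fund_syz_tail G c (val c).2 (val c).1 GF.
  rewrite mcoeff_vsub mcoeff_tvec -surjective_pairing eqxx.
  case: (eqVneq ((G c) (val c).2)@_((val c).1) 1) => // ne.
  by rewrite subr_eq0 => /(_ ne) [_ /mlex_irr].
- by move=> s a /(fund_syz_tail GF) [].
Qed.

(** A normal form of a syzygy has only multiplicative multipliers, so that it
    vanishes by uniqueness of the writing of 0 with respect to F. *)
Lemma fund_syz_basis (G : fam A (next L)) : fund_syz F G ->
  marked_basis G /\ forall p, syz F p <-> mspan G p.
Proof.
move=> GF; have GM := fund_syz_marked GF.
have NP := @next_pommaret K n L.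
have GS p : mspan G p -> syz F p.
  apply: mspan_min => [|c]; [exact: syz_submod|exact: fund_syz_lincomb].
have NF0 p : syz F p -> spanN (L := next L) p -> p = 0.
  move=> Fp Np; apply: (mult_lincomb_eq0 UP FM (g := 0)).
  - by move=> s a /Np /inN_next.
  - exact: spanN0.
  - by rewrite addr0.
split=> [|p].
  split=> //; split=> [v|v /GS]; last exact: NF0.
  have [Q [g [_ Ng ->]]] := writing_exists NP GM v.
  by exists (lincomb Q G), g; split=> //; exists Q.
split=> [Fp|]; last exact: GS.
have [Q [g [_ Ng e]]] := writing_exists NP GM p.
have g0 : g = 0.
  apply: NF0 Ng; have -> : g = p - lincomb Q G by rewrite e addrC addKr.
  have [_ SD _] := syz_submod F; apply: SD => //; apply: submodN.
    exact: syz_submod.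
  by apply: GS; exists Q.
by exists Q; rewrite e g0 addr0.
Qed.

End FundamentalSyzygies.

Lemma marked_basis_uniq (K : fieldType) n (L : level K n) (A : comNzRingType)
    (F F' : fam A L) : marked_basis F -> marked_basis F' ->
  (forall v, mspan F v <-> mspan F' v) -> F =1 F'.
Proof.
move=> [FM [_ disj]] [FM' _] e s; apply/eqP; rewrite -subr_eq0; apply/eqP.
apply: disj.
  have [_ MD _] := mspan_submod F; apply: MD; first exact: mspan_gen.
  by apply: submodN; [exact: mspan_submod|apply/e; exact: mspan_gen].
have [[_ _ N] [_ _ N']] := (FM s, FM' s).
move=> k a; rewrite -(subrKA (tvec A (val s))) => nz.
suff [/N|/N'] : ((F s - tvec A (val s)) k)@_a != 0 \/ ((F' s - tvec A (val s)) k)@_a != 0 by [].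
case: (eqVneq ((F s - tvec A (val s)) k)@_a 0) => [z|]; [right|by left].
by move: nz; rewrite ffunE mcoeffD z add0r -opprB ffunE mcoeffN oppr_eq0.
Qed.

(** * Families of marked elements depending on parameters *)

Section GenericFamilies.
Variables (K : fieldType) (n : nat) (L : level K n).
Notation S := (seq_sub (lpom L)).
Notation bterm := ('X_{1..n.+1 < tbound L} * lidx L)%type.
Variable cond : pred (S * bterm).
Hypothesis condN : forall x, cond x -> inN (unb x.2).
Hypothesis cond_deg : forall x, cond x -> tdeg (ldeg L) (unb x.2) = tdeg (ldeg L) (val x.1).
Hypothesis UP : pommaret_basis (@lU K n L) (lpom L).
Notation idx := {x : S * bterm | cond x}.

(** The common shape of the columns of all the matrices M_t: M_0 is the case of the
    condition Ccond, and M_(t+1) the case of Bcond. *)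
Definition gen (A : comNzRingType) (C : idx -> A) : fam A L :=
  fun s => tvec A (val s) -
    \sum_(x : idx | (val x).1 == s) vscale (C x)%:MP (tvec A (unb (val x).2)).

Lemma unb_inj : injective (@unb K n L).
Proof.
move=> [a k] [b l] e; have /= /val_inj -> := congr1 fst e.
by have /= -> := congr1 snd e.
Qed.

(** The bound on the degrees of parameter terms is thus no restriction. *)
Lemma unb_bound (s : S) (t : term n (lidx L)) :
  tdeg (ldeg L) t = tdeg (ldeg L) (val s) -> exists y : bterm, unb y = t.
Proof.
case: t => a k dt.
suff da : (mdeg a < tbound L)%N by exists (BMultinom da, k).
rewrite /tbound ltnS.
have -> : mdeg a = `|tdeg (ldeg L) (val s) - ldeg L k|%N by rewrite -dt /tdeg /= addrK.
apply: leq_trans (leq_bigmax s).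
exact: (leq_bigmax (F := fun k => `|tdeg (ldeg L) (val s) - ldeg L k|%N)).
Qed.

Variable A : comNzRingType.
Implicit Types (C : idx -> A).

Lemma mcoeff_gen_tail C s k a : ((gen C s - tvec A (val s)) k)@_a =
  - \sum_(x : idx | (val x).1 == s) C x * ((a, k) == unb (val x).2)%:R.
Proof.
rewrite /gen addrAC subrr add0r ffunE mcoeffN sum_ffunE raddf_sum; congr (- _).
by apply: eq_bigr => x _; rewrite /= vscaleE mcoeffCM mcoeff_tvec.
Qed.

Lemma gen_coef C (x : idx) :
  ((gen C (val x).1 - tvec A (val (val x).1)) (unb (val x).2).2)@_((unb (val x).2).1)
    = - C x.
Proof.
rewrite mcoeff_gen_tail (bigD1 x) // big1 => [|y /andP [/eqP ys yx]].
  by rewrite -surjective_pairing eqxx mulr1 /= addr0.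
rewrite -surjective_pairing; case: eqP => [/unb_inj e|]; last by rewrite mulr0.
case/eqP: yx; apply: val_inj; rewrite [RHS]surjective_pairing -ys e.
exact: surjective_pairing.
Qed.

Lemma gen_inj C C' : gen C =1 gen C' -> C =1 C'.
Proof. by move=> e x; apply: oppr_inj; rewrite -!gen_coef e. Qed.

Lemma gen_tail_neq0 C s k a : ((gen C s - tvec A (val s)) k)@_a != 0 ->
  exists2 x : idx, (val x).1 = s & (a, k) = unb (val x).2.
Proof.
rewrite mcoeff_gen_tail => nz; apply: contrapT => H; case/eqP: nz.
rewrite big1 ?oppr0 // => x /eqP xs; case: eqP => [e|]; last by rewrite mulr0.
by case: H; exists x.
Qed.

Lemma gen_marked C : marked_set (gen C).
Proof.
move=> s; have N : spanN (gen C s - tvec A (val s)).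
  by move=> k a /gen_tail_neq0 [x _ ->]; exact: condN (valP x).
have h1 : (gen C s (val s).2)@_((val s).1) = 1.
  have := N (val s).2 (val s).1; rewrite mcoeff_vsub mcoeff_tvec -surjective_pairing eqxx.
  rewrite subr_eq0; case: eqP => // _ /(_ isT) []; exact: lU_pom.
split=> //; exists (tdeg (ldeg L) (val s)) => k a nz.
case: (pselect ((a, k) = val s)) => [->//|ne].
have /gen_tail_neq0 [x <- ->] : ((gen C s - tvec A (val s)) k)@_a != 0.
  by rewrite mcoeff_vsub mcoeff_tvec; case: (_ =P val s) => // _; rewrite subr0.
exact: cond_deg (valP x).
Qed.

Definition gen_param (F : fam A L) : idx -> A :=
  fun x => - (F (val x).1 (unb (val x).2).2)@_((unb (val x).2).1).

Lemma gen_paramK (F : fam A L) :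
  (forall s k a, ((F s - tvec A (val s)) k)@_a != 0 ->
     exists2 y, cond (s, y) & unb y = (a, k)) ->
  F =1 gen (gen_param F).
Proof.
move=> FS s.
suff : F s - tvec A (val s) = gen (gen_param F) s - tvec A (val s) by move/addIr.
have ne (x : idx) : unb (val x).2 <> val (val x).1.
  by move=> e; apply: (condN (valP x)); rewrite e; exact: lU_pom.
have coefF (x : idx) : - gen_param F x =
   ((F (val x).1 - tvec A (val (val x).1)) (unb (val x).2).2)@_((unb (val x).2).1).
  rewrite mcoeff_vsub mcoeff_tvec -surjective_pairing opprK.
  by case: (_ =P val (val x).1) => [/ne|_] //; rewrite subr0.
apply/ffunP => k; apply/mpolyP => a.
case: (pselect (exists2 x : idx, (val x).1 = s & (a, k) = unb (val x).2)) => [[x xs e]|no].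
  have := gen_coef (gen_param F) x; rewrite coefF -e xs /= => ->; by [].
have -> : ((gen (gen_param F) s - tvec A (val s)) k)@_a = 0.
  by apply/eqP/negPn/negP => /gen_tail_neq0.
apply/eqP/negPn/negP => /FS [y cy e]; apply: no.
by exists (exist _ (s, y) cy).
Qed.

Lemma vmap_gen (B : comNzRingType) (phi : {rmorphism A -> B}) C s :
  vmap phi (gen C s) = gen (fun x => phi (C x)) s.
Proof.
rewrite vmapB vmap_tvec vmap_sum; congr (_ - _); apply: eq_bigr => x _.
by rewrite vmapZ vmap_tvec map_mpolyC.
Qed.

End GenericFamilies.

Lemma vmap_writing (K : fieldType) n (L : level K n) (A B : comNzRingType)
    (phi : {rmorphism A -> B}) (F : fam A L) f P g :
  writing F f P g ->
  writing (fun s => vmap phi (F s)) (vmap phi f) (vmap phi P) (vmap phi g).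
Proof.
have nz0 (x : A) : phi x != 0 -> x != 0 by apply: contraNneq => ->; rewrite rmorph0.
case=> h N ->; split=> [s a|k a|].
- by rewrite mcoeff_vmap => /nz0 /h.
- by rewrite mcoeff_vmap => /nz0 /N.
- by rewrite vmapD vmap_lincomb.
Qed.

(** * Quotient rings *)

Section QuotientMaps.
Variables (P : comNzRingType) (G : P -> Prop).

Lemma ideal_gen_in g : G g -> ideal_gen G g.
Proof.
move=> Gg; exists [:: (1, g)]; split=> [p|]; last by rewrite big_seq1 mul1r.
by rewrite inE => /eqP ->.
Qed.

Lemma ideal_gen_idem x : ideal_gen (ideal_gen G) x -> ideal_gen G x.
Proof.
move=> [s [sG ->]]; rewrite big_seq; apply: (big_ind (ideal_gen G)).
- exact: ideal_gen0.
- exact: ideal_genD.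
- by move=> p /sG; exact: ideal_genM.
Qed.

Lemma ideal_gen_kill (R : pzRingType) (phi : {rmorphism P -> R}) :
  (forall g, G g -> phi g = 0) -> forall x, ideal_gen G x -> phi x = 0.
Proof.
move=> h x [s [sG ->]]; rewrite rmorph_sum big_seq big1 // => p /sG /h e.
by rewrite rmorphM e mulr0.
Qed.

Lemma qproj_eq0 x : qproj G x = 0 <-> ideal_gen G x.
Proof. by rewrite -(rmorph0 (qproj G)) qproj_eq subr0. Qed.

Section Lift.
Variables (R : pzRingType) (phi : {rmorphism P -> R}).
Hypothesis phiG : forall x, ideal_gen G x -> phi x = 0.

Definition qlift (q : qring G) : R := phi (sval (cid (qproj_surj q))).

Lemma qliftE x : qlift (qproj G x) = phi x.
Proof.
rewrite /qlift; case: cid => y /= e; apply/eqP; rewrite -subr_eq0 -rmorphB.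
by apply/eqP/phiG/qproj_eq.
Qed.

Fact qlift_additive : zmod_morphism qlift.
Proof.
move=> p q; have [x ->] := qproj_surj p; have [y ->] := qproj_surj q.
by rewrite -rmorphB !qliftE rmorphB.
Qed.

Fact qlift_monoid : monoid_morphism qlift.
Proof.
split=> [|p q]; first by rewrite -(rmorph1 (qproj G)) qliftE rmorph1.
have [x ->] := qproj_surj p; have [y ->] := qproj_surj q.
by rewrite -rmorphM !qliftE rmorphM.
Qed.

Lemma qlift_exists : exists f : {rmorphism qring G -> R}, forall x, f (qproj G x) = phi x.
Proof.
pose a := GRing.isZmodMorphism.Build _ _ qlift qlift_additive.
pose b := GRing.isMonoidMorphism.Build _ _ qlift qlift_monoid.
pose f : {rmorphism qring G -> R} := HB.pack qlift a b.
by exists f => x; exact: qliftE.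
Qed.

End Lift.

(** Modules over polynomial rings are only considered for nontrivial coefficient
    rings, so the quotient by a proper ideal has to be made into one. Statements
    about membership in an improper ideal are trivial, which is why properness
    can always be assumed. *)
Lemma nz_quotient : ~ ideal_gen G 1 ->
  exists (Q : comNzRingType) (phi : {rmorphism P -> Q}),
    forall x, phi x = 0 <-> ideal_gen G x.
Proof.
move=> nz; have nz1 : (1 : qring G) != 0.
  by apply/eqP; rewrite -(rmorph1 (qproj G)) => /qproj_eq0.
pose a := GRing.PzSemiRing_isNonZero.Build (qring G) nz1.
pose Q : comNzRingType := HB.pack (qring G) a.
pose b := GRing.isZmodMorphism.Build P Q (qproj G) (@qproj_additive P G).
pose c := GRing.isMonoidMorphism.Build P Q (qproj G) (@qproj_monoid P G).
pose phi : {rmorphism P -> Q} := HB.pack (qproj G : P -> Q) b c.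
exists Q, phi => x; exact: qproj_eq0.
Qed.

End QuotientMaps.

(** * The chain of syzygies defined by values of the parameters *)

Lemma Dmin_le n m (P : seq (term n 'I_m)) s :
  s \in P -> s.1 != 0%MM -> (Dmin P <= minv s.1)%N.
Proof.
rewrite /Dmin => sP s0; elim: P sP => // s' P IH.
rewrite inE big_cons => /orP [/eqP <-|/IH le]; first by rewrite s0 geq_minl.
by case: ifP => // _; exact: leq_trans (geq_minr _ _) le.
Qed.

Section Resolution.
Variables (K : fieldType) (n m : nat) (d : 'I_m -> int).
Variables (U : vec K n 'I_m -> Prop) (P : seq (term n 'I_m)).
Hypothesis UP : pommaret_basis U P.
Notation Lv t := (lev (L0 d U P) t).
Notation r := (reslen P).
Notation CB := (CBidx d U P).
Notation KCB := (KCB d U P).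

Lemma lev_pommaret t : pommaret_basis (@lU K n (Lv t)) (lpom (Lv t)).
Proof. by case: t => [|t]; [exact: UP | exact: next_pommaret]. Qed.

(** If n = D, then no equations are imposed and no B exists; correspondingly every
    marked set is a marked basis, since all variables are multiplicative. *)
Lemma next_pom_nil : r = 0%N -> forall s i, ~ nonmult (val (s : seq_sub (lpom (L0 d U P)))).1 i.
Proof.
move=> r0 s i /existsP [j /andP [sj ji]].
have sP : val s \in P := valP s.
have s0 : (val s).1 != 0%MM by apply: contraNneq sj => ->; rewrite mnm0E.
have [_ mj] := minvP sj.
have : (Dmin P <= minv (val s).1)%N.
  exact: Dmin_le.
move/eqP: r0; rewrite subn_eq0 => nD Ds.
have jn : (j < n)%N := leq_trans ji (ltn_ord i : (i <= n)%N).
by have := leq_trans nD (leq_trans Ds mj); rewrite leqNgt jn.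
Qed.

Lemma CcondN x : Ccond (d := d) (U := U) (P := P) x -> inN (unb x.2).
Proof. by case/andP => /asboolP. Qed.

Lemma Ccond_deg x : Ccond (d := d) (U := U) (P := P) x ->
  tdeg (ldeg (L0 d U P)) (unb x.2) = tdeg (ldeg (L0 d U P)) (val x.1).
Proof. by case/andP => _ /eqP. Qed.

Lemma BcondN t x : Bcond (d := d) (U := U) (P := P) (t := t) x -> inN (unb x.2).
Proof. by case/and3P => /asboolP. Qed.

Lemma Bcond_deg t x : Bcond (d := d) (U := U) (P := P) (t := t) x ->
  tdeg (ldeg (Lv t.+1)) (unb x.2) = tdeg (ldeg (Lv t.+1)) (val x.1).
Proof. by case/and3P => _ /eqP. Qed.

Section Chains.
Variable A : comNzRingType.
Implicit Types (v : CB -> A).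

Definition Btag (t : 'I_r) (x : Bidx d U P t) : CB :=
  inr (Tagged (fun t : 'I_r => Bidx d U P t : Type) x).

Definition Bval v t (x : Bidx d U P t) : A :=
  match pselect (t < r)%N with
  | left lt => v (@Btag (Ordinal lt) x)
  | right _ => 0
  end.

Lemma BvalE v (t : 'I_r) (x : Bidx d U P t) : Bval v x = v (Btag x).
Proof.
rewrite /Bval; case: t x => t lt x /=; case: pselect => // lt'.
by rewrite (bool_irrelevance lt' lt).
Qed.

(** The families obtained from the matrices M_t by giving the parameters the values
    v. Beyond the length of the resolution, where there are no parameters, all
    tails are 0. *)
Definition chain v t : fam A (Lv t) :=
  match t return fam A (Lv t) with
  | 0 => genF (fun x => v (inl x))
  | t'.+1 => gen (cond := @Bcond K n m d U P t') (Bval v (t := t'))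
  end.
Arguments chain v t _ : clear implicits.

Lemma eq_chain v v' t : (forall x, v (inl x) = v' (inl x)) ->
  (forall (u : 'I_r) (x : Bidx d U P u), (u < t)%N -> v (Btag x) = v' (Btag x)) ->
  chain v t =1 chain v' t.
Proof.
case: t => [|t] eC eB s; congr (_ - _); apply: eq_bigr => x _; first by rewrite eC.
by rewrite /Bval; case: pselect => // tr; rewrite eB.
Qed.

Lemma genF_marked (C : Cidx d U P -> A) : marked_set (genF C).
Proof. exact: (gen_marked CcondN Ccond_deg (lev_pommaret 0)). Qed.

Lemma chain_marked v t : marked_set (chain v t).
Proof.
case: t => [|t]; first exact: genF_marked.
exact: (gen_marked (@BcondN t) (@Bcond_deg t) (lev_pommaret t.+1)).
Qed.

Lemma chain_fund_syz v t :
  (forall c, lincomb (chain v t.+1 c) (chain v t) = 0) ->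
  fund_syz (chain v t) (chain v t.+1).
Proof.
apply: fund_syzI => c; by have [] := @chain_marked v t.+1 c.
Qed.

(** The equations for t = 0 give a writing without normal form of each x_i F_s, so
    that the criterion for marked bases applies. *)
Lemma chain_basis0 v :
  ((0 < r)%N -> fund_syz (chain v 0) (chain v 1)) -> marked_basis (chain v 0).
Proof.
move=> h; apply: (marked_basis_criterion (lev_pommaret 0)); first exact: chain_marked.
move=> s i ni; case: (posnP r) => [r0|/h FS]; first by case: (next_pom_nil r0 ni).
have cN : (U_(i)%MM, s) \in lpom (Lv 1) by apply/next_pomP; exists i.
by have [Q w _] := FS (SeqSub cN); exists Q; move: w; rewrite lincomb_tvec.
Qed.

Lemma fund_syz_iter (G : forall t, fam A (Lv t)) :
  marked_basis (G 0%N) -> (forall t, (t < r)%N -> fund_syz (G t) (G t.+1)) ->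
  forall t, (t <= r)%N -> marked_basis (G t).
Proof.
move=> G0 GS; elim=> [//|t IH] tr.
by have [] := fund_syz_basis (lev_pommaret t) (IH (ltnW tr)) (GS t tr).
Qed.

(** Every tail coefficient of a fundamental syzygy belongs to some parameter: the
    multipliers in the writing of x_i f are smaller than x_i, so they involve only
    x_0, ..., x_(i-1), and being multiplicative for s they involve no variable
    above min(s). *)
Lemma chain_complete (G : forall t, fam A (Lv t)) :
  marked_basis (G 0%N) -> (forall t, (t < r)%N -> fund_syz (G t) (G t.+1)) ->
  exists v, forall t, (t <= r)%N -> G t =1 chain v t.
Proof.
move=> G0 GS.
pose v (y : CB) : A := match y with
  | inl x => gen_param (G 0%N) x
  | inr x => gen_param (cond := @Bcond K n m d U P (tag x)) (G (tag x).+1) (tagged x)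
  end.
exists v => -[_|t tr] s.
  apply: (gen_paramK CcondN (lev_pommaret 0)) => {}s k a nz.
  have [_ _ sN] := G0.1 s; have Nt := sN _ _ nz.
  have dt : tdeg (ldeg (L0 d U P)) (a, k) = tdeg (ldeg (L0 d U P)) (val s).
    apply: (marked_homog G0.1 (s := s)); move: nz; rewrite mcoeff_vsub mcoeff_tvec.
    by case: (_ =P val s) Nt => [->|_ _]; [case; exact: (lU_pom (lev_pommaret 0))|rewrite subr0].
  have [y ey] := unb_bound dt; exists y => //.
  by rewrite /Ccond /= ey dt eqxx andbT; apply/asboolP.
have Gt := fund_syz_iter G0 GS (ltnW tr).
have := @gen_paramK _ _ _ _ (@BcondN t) (lev_pommaret t.+1) _ (G t.+1) _ s.
rewrite /chain => ->; last first.
  move=> {}s k a /(fund_syz_tail (lev_pommaret t) Gt (GS t tr)) [Nt la dt].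
  have [y ey] := unb_bound dt; exists y => //.
  apply/and3P; split=> /=; first by rewrite ey; apply/asboolP.
    by rewrite ey dt.
  have [i [s' [se ni]]] := next_pomE s.
  have [e1 e2] : bmnm y.1 = a /\ y.2 = k.
    by split; [exact: (congr1 fst ey)|exact: (congr1 snd ey)].
  apply/forallP => j; apply/implyP; rewrite e1 e2 => aj.
  move: la; rewrite se /= => la.
  have /= -> : minv (val s).1 = i by rewrite se minvU.
  rewrite (mlexU la aj) /=; apply: nonmult_minv; apply/negP => nj.
  by move/inN_next: Nt => /(_ j nj) aj0; rewrite aj0 in aj.
congr (_ - _); apply: eq_bigr => x _.
by rewrite (BvalE v (t := Ordinal tr)).
Qed.

Lemma fund_syz_iter_exists (F : fam A (Lv 0)) : marked_basis F ->
  exists2 G : forall t, fam A (Lv t), G 0%N = F &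
    forall t, fund_syz (G t) (G t.+1).
Proof.
move=> FB.
pose step t (H : fam A (Lv t)) : fam A (Lv t.+1) :=
  match pselect (exists G, fund_syz H G) with
  | left h => sval (cid h) | right _ => fun _ => 0 end.
pose G := fix G t : fam A (Lv t) := if t is t'.+1 then step t' (G t') else F.
exists G => //.
suff H t : marked_basis (G t) /\ fund_syz (G t) (G t.+1) by move=> t; case: (H t).
have GS t' : marked_basis (G t') -> fund_syz (G t') (G t'.+1).
  move=> GB; rewrite /= /step; case: pselect => [h|[]]; first by case: cid.
  exact: (fund_syz_exists (lev_pommaret t') GB).
elim: t => [|t [IH1 IH2]]; first by split=> //; exact: GS.
by have [B _] := fund_syz_basis (lev_pommaret t) IH1 IH2; split=> //; exact: GS.
Qed.

Lemma chain_exists (C : Cidx d U P -> A) : marked_basis (genF C) ->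
  exists2 v, (forall x, v (inl x) = C x) &
    forall t, (t < r)%N -> fund_syz (chain v t) (chain v t.+1).
Proof.
move=> CB; have [G G0 GS] := fund_syz_iter_exists CB.
have [v vG] : exists v, forall t, (t <= r)%N -> G t =1 chain v t.
  by apply: chain_complete => [|t _]; rewrite ?G0.
exists v => [x|t tr].
  by have := vG 0%N (leq0n _); rewrite G0 => /gen_inj /(_ x) ->.
by rewrite -(funext (vG t (ltnW tr))) -(funext (vG t.+1 tr)).
Qed.

(** A marked basis is determined by its module, and fundamental syzygies are
    determined by the basis. So all parameters are functions of the module. *)
Lemma chain_uniq v v' :
  (forall t, (t < r)%N -> fund_syz (chain v t) (chain v t.+1)) ->
  (forall t, (t < r)%N -> fund_syz (chain v' t) (chain v' t.+1)) ->
  (forall f, mspan (chain v 0) f <-> mspan (chain v' 0) f) -> v =1 v'.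
Proof.
move=> vS vS' e.
have B := chain_basis0 (vS 0%N); have B' := chain_basis0 (vS' 0%N).
have ve t : (t <= r)%N -> chain v t =1 chain v' t.
  elim: t => [_|t IH tr]; first exact: marked_basis_uniq.
  apply: (fund_syz_uniq (lev_pommaret t) (fund_syz_iter B vS (ltnW tr)) (vS t tr)).
  by rewrite (funext (IH (ltnW tr))); exact: vS'.
move=> [x|[t x]]; first exact: (gen_inj (ve 0%N (leq0n _))).
by have := gen_inj (ve t.+1 (ltn_ord t)) x; rewrite !BvalE.
Qed.

End Chains.
Arguments chain {A} v t _.

Lemma vmap_chain (A B : comNzRingType) (phi : {rmorphism A -> B}) v t s :
  vmap phi (chain v t s) = chain (fun i => phi (v i)) t s.
Proof.
case: t s => [|t] s; first by rewrite /chain; exact: vmap_gen.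
rewrite [LHS]vmap_gen; congr (_ - _); apply: eq_bigr => x _.
by rewrite /Bval; case: pselect => // _; rewrite rmorph0.
Qed.

Definition var (i : CB) : KCB := 'X_(enum_rank i).

Lemma Mmat_chain t (lt : (t <= r)%N) s : Mmat (d := d) (U := U) lt s = chain var t s.
Proof.
case: t lt s => [lt s|t lt s]; first exact: erefl.
have -> : chain var t.+1 s = MB (t := Ordinal lt) s; last exact: erefl.
rewrite /chain /gen /MB; congr (_ - _); apply: eq_bigr => x _.
by rewrite (BvalE _ (t := Ordinal lt)).
Qed.

Section Points.
Variables (A : comNzRingType) (phi : {rmorphism KCB -> A}).
Let v := fun i => phi (var i).

(** Matrix products commute with base change, and a column of the shape of those of
    M_(t+1) that is a syzygy is a fundamental one. *)
Lemma idealS_kill (t : 'I_r) :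
  (forall x, idealS (d := d) (U := U) t x -> phi x = 0) <->
  fund_syz (chain v t) (chain v t.+1).
Proof.
have key c : lincomb (chain v t.+1 c) (chain v t) =
    vmap phi (lincomb (Mmat (d := d) (U := U) (ltn_ord t) c) (Mmat (ltnW (ltn_ord t)))).
  rewrite vmap_lincomb Mmat_chain vmap_chain; apply: eq_lincomb => s.
  by rewrite Mmat_chain vmap_chain.
split=> [h|/fund_syz_lincomb h].
  apply: chain_fund_syz => c; rewrite key; apply/ffunP => k; apply/mpolyP => a.
  rewrite mcoeff_vmap [in RHS]ffunE mcoeff0; apply: h; apply: ideal_gen_in.
  by exists c, k, a.
apply: ideal_gen_kill => _ [c [k [a ->]]].
by rewrite -mcoeff_vmap -key h ffunE mcoeff0.
Qed.

Lemma idealSsum_kill :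
  (forall x, idealSsum d U P x -> phi x = 0) <->
  forall t, (t < r)%N -> fund_syz (chain v t) (chain v t.+1).
Proof.
split=> [h t tr|h].
  apply/(idealS_kill (Ordinal tr)) => x tx; apply: h; apply: ideal_gen_in.
  by exists (Ordinal tr).
apply: ideal_gen_kill => x [t]; move: x; apply/idealS_kill; exact: h.
Qed.

End Points.

Lemma eval_exists (A : comNzRingType) (iota : {rmorphism K -> A}) (v : CB -> A) :
  exists phi : {rmorphism KCB -> A},
    (forall c, phi c%:MP = iota c) /\ forall i, phi (var i) = v i.
Proof.
pose h (i : 'I_#|CB|) := v (enum_val i).
exists (mmap iota h : {rmorphism _ -> _}); split=> [c|i] /=; first exact: mmapC.
by rewrite mmapX mmap1U /h enum_rankK.
Qed.

End Resolution.
Arguments chain {K n m d U P A} v t _.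
Arguments var {K n m d U P} i.

(** * Representability and elimination *)

Section PolynomialMorphisms.
Variables (N : nat) (R : comNzRingType).

Lemma mpoly_subring_ind (W : {mpoly R[N]} -> Prop) :
  (forall c, W c%:MP) -> (forall p q, W p -> W q -> W (p + q)) ->
  (forall p q, W p -> W q -> W (p * q)) ->
  forall p, (forall i, (exists2 a, a \in msupp p & a i != 0%N) -> W 'X_i) -> W p.
Proof.
move=> WC WD WM p WX; rewrite [p]mpolyE big_seq.
apply: (big_ind W) => // [|a ap]; first by rewrite -mpolyC0.
rewrite -mul_mpolyC; apply: (WM) => //; rewrite mpolyXE_id.
apply: (big_ind W) => [||i _]; [by rewrite -mpolyC1 | exact: WM |].
case ai: (a i) => [|e]; first by rewrite expr0 -mpolyC1.
have Wi : W 'X_i by apply: WX; exists a => //; rewrite ai.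
by elim: e {ai} => [|e IH]; rewrite ?expr1 // exprS; apply: WM.
Qed.

Lemma mpoly_rmorph_ext (S : pzRingType) (f g : {rmorphism {mpoly R[N]} -> S}) :
  (forall c, f c%:MP = g c%:MP) -> (forall i, f 'X_i = g 'X_i) -> f =1 g.
Proof.
move=> eC eX p; apply: (@mpoly_subring_ind (fun p => f p = g p)) => // [q q'|q q'].
  by move=> e e'; rewrite !rmorphD e e'.
by move=> e e'; rewrite !rmorphM e e'.
Qed.

End PolynomialMorphisms.

Section Representability.
Variables (K : fieldType) (n m : nat) (d : 'I_m -> int).
Variables (U : vec K n 'I_m -> Prop) (P : seq (term n 'I_m)).
Hypothesis UP : pommaret_basis U P.
Notation Lv t := (lev (L0 d U P) t).
Notation r := (reslen P).
Notation CB := (CBidx d U P).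
Notation KCB := (KCB d U P).
Notation KC := (KC d U P).
Notation IS := (idealSsum d U P).

Lemma var_enum (i : 'I_#|CB|) : 'X_i = var (enum_val i) :> KCB.
Proof. by rewrite /var enum_valK. Qed.

Section KPoints.
Variable A : comAlgType K.

Definition pt_morph (h : kpoint IS A) : {rmorphism KCB -> A} := kpoint_fun h \o qproj IS.

Definition pt (h : kpoint IS A) : CB -> A := fun i => pt_morph h (var i).

Lemma pt_chain h t : (t < r)%N -> fund_syz (chain (pt h) t) (chain (pt h) t.+1).
Proof.
move: t; apply/(idealSsum_kill UP (pt_morph h)) => x /ideal_gen_in /qproj_eq0.
by rewrite /pt_morph /= => ->; rewrite rmorph0.
Qed.

Lemma pt_basis h : marked_basis (chain (pt h) 0).
Proof. by apply: (chain_basis0 UP); exact: pt_chain. Qed.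

Lemma pt_morphC h c : pt_morph h c%:MP = c%:A.
Proof.
have e : c%:MP = c%:A :> KCB by rewrite alg_mpolyC.
by rewrite e; exact: kpoint_scal.
Qed.

Lemma pt_inj h h' : pt h =1 pt h' -> h =1 h'.
Proof.
move=> e q; have [p ->] := qproj_surj q.
apply: (mpoly_rmorph_ext (f := pt_morph h) (g := pt_morph h')) => [c|i].
  by rewrite !pt_morphC.
by rewrite var_enum; exact: e.
Qed.

Lemma pt_surj (v : CB -> A) :
  (forall t, (t < r)%N -> fund_syz (chain v t) (chain v t.+1)) ->
  exists h : kpoint IS A, pt h =1 v.
Proof.
move=> vS; have [phi [phiC phiX]] := eval_exists (in_alg A) v.
have phiv : (fun i => phi (var i)) = v by apply/funext => i; exact: phiX.
have kill : forall x, ideal_gen (unionS (P := P)) x -> phi x = 0.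
  by apply/(idealSsum_kill UP phi) => t; rewrite phiv; exact: vS.
have kill' x : ideal_gen IS x -> phi x = 0 by apply: ideal_gen_kill; exact: kill.
have [f fE] := qlift_exists kill'.
have fs c : f (qproj IS c%:A) = c%:A.
  have e : c%:MP = c%:A :> KCB by rewrite alg_mpolyC.
  by rewrite fE -e phiC.
by exists (KPoint fs) => i; rewrite -phiX -fE.
Qed.

Definition pt_tuple (h : kpoint IS A) : restuple d U P A :=
  ResTuple (mspan (chain (pt h) 0)) (fun i => syz (chain (pt h) i)).

End KPoints.

Lemma marked_basis_inMf (A : comNzRingType) (F : fam A (L0 d U P)) :
  marked_basis F -> inMf d U P (mspan F).
Proof.
move=> [FM FD]; split=> //; first exact: mspan_submod.
move=> v [p ->].
pose G v' := exists s : seq (vec A n 'I_m),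
    (forall u, u \in s -> mspan F u /\ exists e, is_homog d e u) /\ v' = \sum_(u <- s) u.
have GD u w : G u -> G w -> G (u + w).
  move=> [s [hs ->]] [s' [hs' ->]]; exists (s ++ s'); rewrite big_cat; split=> // z.
  by rewrite mem_cat => /orP [/hs|/hs'].
have G0 : G 0 by exists [::]; rewrite big_nil.
apply: (big_ind G) => // s _; rewrite [p s]mpolyE.
rewrite (big_morph (fun q => vscale q (F s)) (fun q q' => vscaleDl q q' _) (vscale0l _)).
apply: (big_ind G) => // a _; set u := vscale _ _.
exists [:: u]; rewrite big_seq1; split=> // w; rewrite inE => /eqP -> {w}; split.
  by have [_ _ MZ] := mspan_submod F; apply: MZ; exact: mspan_gen.
exists (tdeg d (tmul a (val s))) => k b.
rewrite /u vscaleE -scalerAl mcoeffZ => nz.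
have : ('X_[a] * F s k)@_b != 0 by apply: contraNneq nz => ->; rewrite mulr0.
move/mcoeffM_neq0 => [a' [b' [-> ]]]; rewrite mcoeffX.
case: (a =P a') => [<- _ nb|_]; last by rewrite eqxx.
transitivity (tdeg d (tmul a (b', k))) => //; rewrite !tdeg_tmul; congr (_ + _).
exact: (marked_homog FM nb).
Qed.

(** A point is sent to the module generated by the specialised marked set, together
    with its iterated syzygy modules. Naturality of the latter rests on the fact
    that they are generated by the next family of the chain: this is compatible
    with base change, whereas forming syzygies in general is not. *)
Lemma Mfres_represented : represented_by (Mfres d U P) IS.
Proof.
exists pt_tuple; split=> [A h _|A h h' _|A T _|A B phi h h' _ _ hh].
- split; first exact: marked_basis_inMf (pt_basis h).
  exists (chain (pt h)); split=> //; first exact: pt_basis.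
  by move=> t; exact: pt_chain.
- move=> [eM _]; apply: pt_inj.
  by apply: (chain_uniq UP) => [t|t|//]; exact: pt_chain.
- move=> [_ [G [GB GM GS Gsyz]]].
  have [v vG] := chain_complete UP GB GS.
  have vS t : (t < r)%N -> fund_syz (chain v t) (chain v t.+1).
    by move=> tr; rewrite -(funext (vG t (ltnW tr))) -(funext (vG t.+1 tr)); exact: GS.
  have [h /funext hv] := pt_surj vS.
  have e t : (t <= r)%N -> G t = chain v t by move=> tr; apply/funext; exact: vG.
  exists h; rewrite /pt_tuple hv; split=> [w|i p].
    by have := GM w; rewrite (e _ (leq0n _)) => -[h1 h2]; split.
  by have := Gsyz i p; rewrite (e _ (ltnW (ltn_ord i))) => -[h1 h2]; split.
have ptE : pt h' = fun i => phi (pt h i).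
  by apply/funext => i; rewrite /pt /pt_morph /= hh.
have chE t : (fun s => vmap phi (chain (pt h) t s)) = chain (pt h') t.
  by rewrite ptE; apply/funext => s; exact: vmap_chain.
split=> [w|i w].
  by have := extend_mspan phi (chain (pt h) 0) w; rewrite chE => -[h1 h2]; split.
have syzE A' (g : kpoint IS A') (p : vec A' n (lidx (Lv i.+1))) :
    syz (chain (pt g) i) p <-> mspan (chain (pt g) i.+1) p.
  have Bi := fund_syz_iter UP (pt_basis g) (pt_chain g) (ltnW (ltn_ord i)).
  by have [_] := fund_syz_basis (lev_pommaret d UP i) Bi (pt_chain g (ltn_ord i)).
have e := extend_mspan phi (chain (pt h) i.+1) w; rewrite chE in e.
apply: (iff_trans (syzE _ h' w)); apply: (iff_trans (iff_sym e)).
by apply: eq_extend => p; apply: iff_sym; exact: syzE.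
Qed.

Definition CtoCB_morph : {rmorphism KC -> KCB} :=
  comp_mpoly [tuple 'X_(enum_rank (inl (enum_val i) : CB)) | i < #|Cidx d U P|].

Lemma CtoCBX x : CtoCB_morph 'X_(enum_rank x) = var (inl x).
Proof. by rewrite /CtoCB_morph /= comp_mpolyXU -tnth_nth tnth_mktuple enum_rankK. Qed.

Lemma ideal_gen1 (R : comNzRingType) (G : R -> Prop) x : ideal_gen G 1 -> ideal_gen G x.
Proof. by rewrite -[x]mulr1; exact: ideal_genM. Qed.

(** Modulo the S^(t) the generic marked set becomes a marked basis, so that the
    normal forms of the x_i F_s vanish. *)
Lemma idealU_sub p : idealU d U P p -> IS (CtoCB p).
Proof.
case: (pselect (IS 1)) => [/ideal_gen1 h _|nz]; first exact: h.
have [Q [phi phi0]] := nz_quotient nz.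
move=> Up; apply/phi0; move: p Up.
pose psi : {rmorphism KC -> Q} := phi \o CtoCB_morph.
apply: (ideal_gen_kill (phi := psi)) => u [c [p [g [w [k [a ->]]]]]].
pose v i := phi (var i).
have vS : forall t, (t < r)%N -> fund_syz (chain v t) (chain v t.+1).
  by apply/(idealSsum_kill UP phi) => x; rewrite phi0.
have FE : (fun s => vmap psi (genF (fun x => 'X_(enum_rank x) : KC) s)) = chain v 0.
  apply/funext => s; rewrite [LHS]vmap_gen; congr (_ - _); apply: eq_bigr => x _.
  by rewrite /psi /= CtoCBX.
have {}w := vmap_writing psi w; rewrite FE vmap_lincomb FE in w.
rewrite -mcoeff_vmap (marked_basis_writing (chain_basis0 UP (vS 0%N)) w); last by eexists.
by rewrite ffunE mcoeff0.
Qed.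

(** Modulo the normal form coefficients the generic marked set is a marked basis,
    whose iterated fundamental syzygies provide values for the B. This extends the
    quotient map of K[C] to a morphism on K[C, B] that kills all S^(t). *)
Lemma idealS_contract p : IS (CtoCB p) -> idealU d U P p.
Proof.
case: (pselect (idealU d U P 1)) => [/ideal_gen1 h _|nz]; first exact: h.
have [Q [psi psi0]] := nz_quotient nz.
pose C x := psi 'X_(enum_rank x).
pose FU := genF (fun x => 'X_(enum_rank x) : KC).
have FUM : marked_set FU := genF_marked UP _.
have FE : (fun s => vmap psi (FU s)) = genF C.
  by apply/funext => s; exact: vmap_gen.
have CB : marked_basis (genF C).
  apply: (marked_basis_criterion (lev_pommaret d UP 0) (genF_marked UP C)) => s i ni.
  have cN : (U_(i)%MM, s) \in lpom (next (L0 d U P)) by apply/next_pomP; exists i.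
  have [R [g w]] := writing_exists (lev_pommaret d UP 0) FUM
    (lincomb (tvec KC (val (SeqSub cN))) FU).
  have := vmap_writing psi w; rewrite FE vmap_lincomb FE vmap_tvec lincomb_tvec.
  have -> : vmap psi g = 0; last by exists (vmap psi R).
  apply/ffunP => k; apply/mpolyP => a; rewrite mcoeff_vmap [in RHS]ffunE mcoeff0.
  by apply/psi0/ideal_gen_in; exists (SeqSub cN), R, g; split=> //; exists k, a.
have [v vC vS] := chain_exists UP CB.
have [phi [phiC phiX]] := eval_exists (psi \o @mpolyC _ K : {rmorphism K -> Q}) v.
have kill : forall x, IS x -> phi x = 0.
  have phiv : (fun i => phi (var i)) = v by apply/funext => i; exact: phiX.
  by apply/(idealSsum_kill UP phi) => t; rewrite phiv; exact: vS.
move/kill => e; apply/psi0; rewrite -e.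
apply: (mpoly_rmorph_ext (f := psi) (g := phi \o CtoCB_morph)) => [c|i] /=.
  by rewrite comp_mpolyC phiC.
by rewrite -[i]enum_valK -/(CtoCB_morph _) CtoCBX phiX vC.
Qed.

Lemma in_KCBlt_subring t :
  [/\ forall c, in_KCBlt (d := d) (U := U) (P := P) t c%:MP,
      forall p q : KCB, in_KCBlt t p -> in_KCBlt t q -> in_KCBlt t (p + q) &
      forall p q : KCB, in_KCBlt t p -> in_KCBlt t q -> in_KCBlt t (p * q)].
Proof.
split=> [c a|p q hp hq a|p q hp hq a].
- rewrite msuppC; case: ifP => // _; rewrite inE => /eqP -> i.
  by rewrite mnm0E.
- by move/msuppD_le; rewrite mem_cat => /orP [/hp|/hq].
- rewrite mcoeff_msupp => /mcoeffM_neq0 [b [c [-> ]]].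
  rewrite -!mcoeff_msupp => /hp pb /hq qc i; rewrite mnmDE addn_eq0 negb_and.
  by case/orP => [/pb|/qc].
Qed.

Lemma in_KCBlt_var t (i : CB) :
  (if i is inr x then (tag x < t)%N else true) -> in_KCBlt t (var i).
Proof.
move=> it a; rewrite msuppX inE => /eqP -> j; rewrite mnm1E.
by case: (enum_rank i =P j) => // <- _; rewrite enum_rankK.
Qed.

(** The x_i f have writings with respect to the columns of M_t already before any
    equation is imposed. Modulo S^(t+1) they are unique and agree with the columns
    of M_(t+1), so each B^(t+1) is congruent to a coefficient of such a writing. *)
Lemma Bvar_eliminate (t : 'I_r) (b : Bidx d U P t) :
  exists2 g : KCB, in_KCBlt t g & idealS t (Bvar b - g).
Proof.
have [inC inD inM] := in_KCBlt_subring t.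
case: (pselect (idealS (d := d) (U := U) t 1)) => [/ideal_gen1 h|nz].
  by exists 0; [rewrite -mpolyC0; exact: inC|exact: h].
have [Q [phi phi0]] := nz_quotient nz.
pose c := (val b).1.
have VM := chain_marked UP (var (d := d) (U := U) (P := P)) (t := t).
have LP := lev_pommaret d UP t.
have [p [g w]] := writing_exists LP VM (lincomb (tvec KCB (val c)) (chain var t)).
exists ((p (unb (val b).2).2)@_((unb (val b).2).1)).
  (* the writing is fixed by the endomorphism theta that annihilates the later
     parameters, because M_t does not involve them; hence its coefficients lie in
     the image of theta *)
  pose v' i : KCB := if i is inr x then if (tag x < t)%N then var i else 0 else var i.
  have [theta [thC thX]] := eval_exists (@mpolyC _ K : {rmorphism K -> KCB}) v'.
  have chE : (fun s => vmap theta (chain var t s)) = chain var t.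
    apply/funext => s; rewrite vmap_chain; apply: eq_chain => [x|u x ut].
      by rewrite thX.
    by rewrite thX /v' /= ut.
  have := vmap_writing theta w; rewrite chE vmap_lincomb chE vmap_tvec.
  move/(writing_uniq LP VM w) => [-> _]; rewrite mcoeff_vmap.
  apply: (@mpoly_subring_ind _ _ (fun q => in_KCBlt t (theta q))) => [e|q q'|q q'|i _].
  - by rewrite thC; exact: inC.
  - by rewrite rmorphD; exact: inD.
  - by rewrite rmorphM; exact: inM.
  rewrite var_enum thX /v'; case: (enum_val i) => [x|x]; first exact: in_KCBlt_var.
  by case: ifP => xt; [exact: in_KCBlt_var|rewrite -mpolyC0; exact: inC].
apply/phi0; rewrite rmorphB; apply/eqP; rewrite subr_eq0; apply/eqP.
pose v i := phi (var i).
have vS : fund_syz (chain v t) (chain v t.+1).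
  by apply/(idealS_kill UP phi) => x; rewrite phi0.
have chE : (fun s => vmap phi (chain var t s)) = chain v t.
  by apply/funext => s; rewrite vmap_chain.
have := vmap_writing phi w; rewrite chE vmap_lincomb chE vmap_tvec.
have [R wR eR] := vS c.
move/(writing_uniq LP (chain_marked UP v (t := t)) wR) => [eP _].
rewrite -mcoeff_vmap -eP.
have := gen_coef (Bval v (t := t)) b; rewrite -/c -/(chain v t.+1) eR.
rewrite addrAC subrr add0r mcoeff_vopp => /oppr_inj ->.
by rewrite BvalE.
Qed.

(** The B are eliminated one level after the other, by induction on t. *)
Lemma CtoCB_surj (q : KCB) : exists p : KC, IS (q - CtoCB p).
Proof.
pose W q := exists p : KC, IS (q - CtoCB_morph p).
suff : W q by [].
have IS0 : IS 0 := ideal_gen0 _.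
have WC c : W c%:MP.
  by exists c%:MP; rewrite (_ : CtoCB_morph _ = c%:MP) ?subrr //; exact: comp_mpolyC.
have WD p p' : W p -> W p' -> W (p + p').
  move=> [x e] [x' e']; exists (x + x').
  by rewrite rmorphD opprD addrACA; exact: ideal_genD.
have WM p p' : W p -> W p' -> W (p * p').
  move=> [x e] [x' e']; exists (x * x'); rewrite rmorphM.
  have -> : p * p' - CtoCB_morph x * CtoCB_morph x' =
      p' * (p - CtoCB_morph x) + CtoCB_morph x * (p' - CtoCB_morph x').
    by rewrite !mulrBr addrA [p' * CtoCB_morph x]mulrC subrK [p' * p]mulrC.
  by apply: ideal_genD; exact: ideal_genM.
have WX x : W (var (inl x)).
  by exists 'X_(enum_rank x); rewrite CtoCBX subrr.
have WB N (t : 'I_r) (b : Bidx d U P t) : (t < N)%N -> W (var (Btag b)).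
  elim: N t b => // N IH t b tN.
  have [g gt gS] := Bvar_eliminate b.
  have [p e] : W g.
    apply: mpoly_subring_ind => // i [a ag ai]; rewrite var_enum.
    have := gt a ag i ai; case: (enum_val i) => [x _|[t' b'] /= tt]; first exact: WX.
    by apply: IH; exact: leq_trans tt _.
  exists p; rewrite -[var _](subrK g) -addrA; apply: ideal_genD => //.
  by apply: ideal_gen_in; exists t.
apply: mpoly_subring_ind => // i _; rewrite var_enum.
case: (enum_val i) => [x|[t b]]; [exact: WX | exact: (WB t.+1)].
Qed.

Lemma elimination_iso :
  exists f : {rmorphism qring (idealU d U P) -> qring IS},
    bijective f /\ forall p : KC, f (qproj (idealU d U P) p) = qproj IS (CtoCB p).
Proof.
pose phi : {rmorphism KC -> qring IS} := qproj IS \o CtoCB_morph.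
have kill x : ideal_gen (idealU d U P) x -> phi x = 0.
  move/ideal_gen_idem/idealU_sub => h.
  by apply/qproj_eq0; apply: ideal_gen_in.
have [f fE] := qlift_exists kill.
exists f; split; last exact: fE.
have f_inj : injective f.
  move=> x y; have [p ->] := qproj_surj x; have [q ->] := qproj_surj y.
  rewrite !fE => e; apply/qproj_eq/ideal_gen_in/idealS_contract.
  have /qproj_eq/ideal_gen_idem : qproj IS (CtoCB p) = qproj IS (CtoCB q) := e.
  by rewrite -[CtoCB p - _]/(CtoCB_morph p - CtoCB_morph q) -rmorphB.
have f_surj y : exists x, f x = y.
  have [q ->] := qproj_surj y; have [p h] := CtoCB_surj q.
  exists (qproj _ p); rewrite fE; apply/esym/qproj_eq; exact: ideal_gen_in.
exists (fun y => sval (cid (f_surj y))) => [x|y]; last by case: cid.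
by apply: f_inj; case: cid.
Qed.

End Representability.

Theorem proposition4p13 (K : fieldType) (n m : nat) (d : 'I_m -> int)
    (U : vec K n 'I_m -> Prop) (P : seq (term n 'I_m))
    (UP : pommaret_basis U P) :
  [/\ represented_by (Mfres d U P) (idealSsum d U P),
      forall p : KC d U P, idealU d U P p <-> idealSsum d U P (CtoCB p),
      forall (t : 'I_(reslen P)) (b : Bidx d U P t),
        exists2 g : KCB d U P, in_KCBlt t g & idealS t (Bvar b - g)%R
    & exists f : {rmorphism qring (idealU d U P) -> qring (idealSsum d U P)},
        bijective f /\
        forall p : KC d U P,
          f (qproj (idealU d U P) p) = qproj (idealSsum d U P) (CtoCB p)].
Proof.
split; [exact: Mfres_represented | | exact: Bvar_eliminate | exact: elimination_iso].
by move=> p; split; [exact: idealU_sub | exact: idealS_contract].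
Qed.
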